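(* Let $f:\mathbb{R}\to\mathbb{R}$ be convex with $\lim_{|p|\to\infty}f(p)/|p|=\infty$. For initial data in $L^\infty(\mathbb{R})$, ''HJ-solution'' means the function $\partial V/\partial x$ defined in the context. Then: 1. (Comparison principle) Let $u_{10},u_{20}\in L^\infty(\mathbb{R})$ with HJ-solutions $u_1,u_2$. If $u_{10}(x)\le u_{20}(x)$ for a.e. $x\in\mathbb{R}$, then $u_1(x,t)\le u_2(x,t)$ for a.e. $(x,t)\in\mathbb{R}\times(0,\infty)$. 2. Let $u_{10},u_{20}\in L^1(\mathbb{R})$. For $i=1,2$, let $(u_{i0n})_{n}$ be a sequence in $L^\infty(\mathbb{R})\cap L^1(\mathbb{R})$ converging to $u_{i0}$ in $L^1(\mathbb{R})$, and let $u_{in}$ be the HJ-solution with initial data $u_{i0n}$. Let $T>0$. Then: (a) $(u_{1n})_n$ and $(u_{2n})_n$ are Cauchy sequences in $L^1(\mathbb{R}\times(0,T))$. (b) If $u_i$ denotes the limit of $(u_{in})_n$ in $L^1(\mathbb{R}\times(0,T))$, then for $0<\tau<T$, $$\int_{-\infty}^\infty\int_\tau^T|u_1(x,t)-u_2(x,t)|\,dt\,dx\le(T-\tau)\int_{-\infty}^\infty|u_{10}(x)-u_{20}(x)|\,dx.$$ (c) If, for some $i\in\{1,2\}$, $(v_{i0n})_n$ is another sequence in $L^\infty(\mathbb{R})\cap L^1(\mathbb{R})$ converging to $u_{i0}$ in $L^1(\mathbb{R})$, $v_{in}$ is the HJ-solution with initial data $v_{i0n}$, and $v_i=\lim_n v_{in}$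 in $L^1(\mathbb{R}\times(0,T))$ for all $T>0$, then $u_i(x,t)=v_i(x,t)$ for a.e. $(x,t)\in\mathbb{R}\times(0,\infty)$. 3. Let $u_0\in L^1(\mathbb{R})$, let $(u_{0n})_n$ be a sequence in $L^\infty(\mathbb{R})\cap L^1(\mathbb{R})$ converging to $u_0$ in $L^1(\mathbb{R})$, let $u_n$ be the HJ-solution with initial data $u_{0n}$, and let $u$ be the limit of $(u_n)_n$ in $L^1(\mathbb{R}\times(0,T))$ for all $T>0$. Then: (a) $u\in L^\infty(K)$ for every compact set $K\subset\mathbb{R}\times(0,\infty)$. (b) $\displaystyle\int_0^\infty\int_{-\infty}^\infty[u\varphi_t+f(u)\varphi_x](x,t)\,dx\,dt=0$ for all $\varphi\in C_c^\infty(\mathbb{R}\times(0,\infty))$. (c) $\displaystyle\lim_{t\to0^+}\int_a^b u(x,t)\,dx=\int_a^b u_0(x)\,dx$ for all $[a,b]\subset\mathbb{R}$.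
   Context: Fenchel dual: $f^*(q)=\sup_{p\in\mathbb{R}}\{pq-f(p)\}$, finite for every $q$ when $f$ is convex and super-linear. For $u_0\in L^\infty(\mathbb{R})$ put $v_0(x)=\int_0^x u_0(\theta)\,d\theta$ and, for $t>0$, $V(x,t)=\inf_{y\in\mathbb{R}}\{v_0(y)+tf^*(\frac{x-y}{t})\}$. The function $V$ is Lipschitz, and the HJ-solution (the solution obtained from the Hamilton-Jacobi method) of $u_t+f(u)_x=0$ with initial data $u_0$ is $u=\frac{\partial V}{\partial x}$, defined almost everywhere on $\mathbb{R}\times(0,\infty)$. Since $u$ in part 3 is defined only up to null sets, the limit as $t\to0^+$ in 3(c) is understood for a.e. $t$, i.e. as an essential limit. *)

(* Defs.v *)
(* Elements of L^1 and L^oo are given by Borel measurable representatives. *)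
From HB Require Import structures.
From mathcomp Require Import all_boot all_order all_algebra.
From mathcomp Require Import all_classical all_reals all_analysis.
Import Order.TTheory GRing.Theory Num.Theory.
Import numFieldNormedType.Exports.

Set Implicit Arguments.
Unset Strict Implicit.
Unset Printing Implicit Defensive.

Local Open Scope classical_set_scope.
Local Open Scope ring_scope.

Notation leb := (@lebesgue_measure _).
Notation leb2 := (@lebesgue_measure _ \x @lebesgue_measure _)%E.

Section partial_derivatives.
Context {R : realType}.
Implicit Type g : R * R -> R.

Definition partial_x g (z : R * R) : R := derive1 (fun x => g (x, z.2)) z.1.
Definition partial_t g (z : R * R) : R := derive1 (fun t => g (z.1, t)) z.2.

Fixpoint Ck (k : nat) g : Prop :=
  continuous g /\
  if k is k'.+1 then
    [/\ forall z, derivable (fun x => g (x, z.2)) z.1 1,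
        forall z, derivable (fun t => g (z.1, t)) z.2 1,
        Ck k' (partial_x g) & Ck k' (partial_t g)]
  else True.

(* Functions in C_c^oo(U) are identified with their extension by 0. *)
Definition test_function (U : set (R * R)) g : Prop :=
  [/\ forall k, Ck k g,
      compact (closure [set z | g z != 0]) &
      closure [set z | g z != 0] `<=` U].

End partial_derivatives.

Section function_spaces.
Context d {T : measurableType d} {R : realType}.
Variable mu : {measure set T -> \bar R}.

Definition L1 (D : set T) (u : T -> R) : Prop := mu.-integrable D (EFin \o u).

(* [u \_ D] is [u] on [D] and 0 elsewhere. *)
Definition Loo (D : set T) (u : T -> R) : Prop := (u \_ D) \in Lfun mu +oo%E.

Definition L1dist (D : set T) (u v : T -> R) : \bar R :=
  (\int[mu]_(z in D) `|u z - v z|%:E)%E.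

Definition L1cauchy (D : set T) (un : nat -> T -> R) : Prop :=
  (forall n, L1 D (un n)) /\
  forall e : R, 0 < e -> exists N : nat, forall m n : nat,
    (N <= m)%N -> (N <= n)%N -> (L1dist D (un m) (un n) < e%:E)%E.

Definition L1cvg (D : set T) (un : nat -> T -> R) (u : T -> R) : Prop :=
  L1 D u /\ L1dist D (un n) u @[n --> \oo] --> 0%E.

End function_spaces.

Section hamilton_jacobi.
Context {R : realType}.

Definition halfplane : set (R * R) := [set: R] `*` `]0, +oo[.
Definition strip (T : R) : set (R * R) := [set: R] `*` `]0, T[.

Definition superlinear (f : R -> R) : Prop :=
  f p / `|p| @[p --> +oo] --> +oo /\ f p / `|p| @[p --> -oo] --> +oo.

Definition fenchel (f : R -> R) (q : R) : R := sup [set p * q - f p | p in [set: R]].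

Definition primitive (u0 : R -> R) (x : R) : R :=
  if 0 <= x then \int[leb]_(s in `[0, x]) u0 s
  else - \int[leb]_(s in `[x, 0]) u0 s.

Definition hj_value (f u0 : R -> R) (z : R * R) : R :=
  inf [set primitive u0 y + z.2 * fenchel f ((z.1 - y) / z.2)
      | y in [set: R]].

(* Meaningful on [halfplane] only, where [hj_value f u0] is Lipschitz when [u0]
   is bounded; on the null set of points of [halfplane] where the partial
   derivative does not exist, [derive1] returns a default value. *)
Definition hj_solution (f u0 : R -> R) : R * R -> R := partial_x (hj_value f u0).

(* [g t] tends to [l] as [t -> 0+], up to a null set of [t]. *)
Definition ess_cvg_at_0 (g : R -> \bar R) (l : \bar R) : Prop :=
  forall U : set (\bar R), nbhs l U ->
  exists2 e : R, 0 < e & \forall t \ae leb, 0 < t < e -> U (g t).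

End hamilton_jacobi.

(* Main.v *)
Require Import Defs.
From HB Require Import structures.
From mathcomp Require Import all_boot all_order all_algebra.
From mathcomp Require Import all_classical all_reals all_analysis.
From mathcomp Require Import measurable_realfun ess_sup_inf.
From mathcomp Require Import ring lra.
Import Order.TTheory GRing.Theory Num.Theory.
Import numFieldNormedType.Exports.

Set Implicit Arguments.
Unset Strict Implicit.
Unset Printing Implicit Defensive.

Local Open Scope classical_set_scope.
Local Open Scope ring_scope.

(** Everything rests on the variational formula defining V, the Hopf-Lax
    formula. Exchanging near-minimizers shows that when the primitives of two
    data differ by a nondecreasing function, so do the two values V at each
    time t, and that the oscillation of the difference of the values is at most
    that of the difference of the primitives. Together with u = V_x this gives
    the comparison principle and, through the datum max(u10, u20), the L^1
    contraction at each fixed time. Near-minimizers move at bounded speed for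
    t >= t0, even for data which are merely integrable; hence V is Lipschitz
    there and u := V_x makes sense and is contracted directly for L^1 data. By
    uniqueness of L^1 limits every limit in the statement is such a V_x, and no
    approximation is needed any more.

    For the weak formulation put m(t) = int u(x,t) phi(x,t) dx. By the semigroup
    property V has right time derivative -f(u) wherever V_x = u exists, and an
    integration by parts in x turns the difference quotients of m into integrals
    converging to int (u phi_t + f(u) phi_x) dx. Since m is Lipschitz and
    vanishes outside the time support of phi, the latter integrates to 0. *)

(** At fixed t > 0 the value V(., t) is only Lipschitz, so the passage between V and u needs two
    facts about Lipschitz functions on the line: they are differentiable almost everywhere, and they
    are integrals of their derivatives. Both come from the Radon-Nikodym theorem.

    Going from slices to the plane by Tonelli requires joint measurability of V_x, including the
    points where the derivative does not exist.

    In time V is differentiated from the right only, because the semigroup property runs forward.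
    The flux f returns from its dual there: the infimum over q of [fenchel f q - p * q] is [- f p],
    one inequality being the definition of the dual, the other a subgradient of f at p.

    The initial condition is the pointwise convergence of V(., t) to the primitive of the datum, and
    the local bound on u is the Lipschitz constant of V(., t). *)

(** * Densities of monotone Lipschitz functions *)

Section lipschitz_ftc.
Context {R : realType}.
Implicit Types (F h : R -> R) (a b K : R).

Definition lip K F := forall x y, `|F x - F y| <= K * `|x - y|.

Lemma lip_continuous K F : lip K F -> continuous F.
Proof.
move=> lF x; apply/cvgrPdist_le => e e0.
have K0 : 0 < `|K| + 1 by rewrite ltr_wpDl.
near=> y; apply: (le_trans (lF x y)).
have xy : `|x - y| <= e / (`|K| + 1).
  near: y; apply: cvgr_dist_le; [exact: cvg_id|exact: divr_gt0].
rewrite ler_pdivlMr// mulrC in xy.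
apply: le_trans xy; apply: ler_wpM2r => //.
by rewrite (le_trans (ler_norm _))// lerDl.
Unshelve. all: by end_near. Qed.

(** Both [F] and [x - F x] are nondecreasing, and their Stieltjes measures add up to Lebesgue
    measure. Hence the measure of [F] is absolutely continuous, and [h] is its Radon-Nikodym
    density. *)
Lemma nd_lip1_density F a b : {homo F : x y / x <= y} -> lip 1 F -> a < b ->
  exists2 h, leb.-integrable [set: R] (EFin \o h) &
    forall x, a <= x <= b -> \int[leb]_(t in `]-oo, x]) h t = F x - F a.
Proof.
move=> ndF lF ab.
pose cF := isCumulative.Build _ _ _ F ndF (right_continuousW (lip_continuous lF)).
pose FC : cumulative R R := HB.pack F cF.
pose G x := x - F x.
have ndG : {homo G : x y / x <= y}.
  move=> x y xy; rewrite /G.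
  have := lF y x; rewrite mul1r (ger0_norm (x := y - x)) ?subr_ge0// ger0_norm ?subr_ge0 ?ndF//.
  lra.
have cG : continuous G.
  by move=> x; apply: cvgB; [exact: cvg_id|exact: (lip_continuous lF)].
pose cG' := isCumulative.Build _ _ _ G ndG (right_continuousW cG).
pose GC : cumulative R R := HB.pack G cG'.
pose muF := lebesgue_stieltjes_measure FC.
pose muG := lebesgue_stieltjes_measure GC.
have ocE (H : cumulative R R) x y : x <= y ->
    lebesgue_stieltjes_measure H `]x, y]%classic = (H y - H x)%:E.
  move=> xy; rewrite /lebesgue_stieltjes_measure /measure_extension measurable_mu_extE; last exact: is_ocitv.
  exact: wlength_itv_bnd.
have lebE A : measurable A -> leb A = measure_add muF muG A.
  apply: lebesgue_measure_unique => _ [[x y] _ <-].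
  transitivity (muF `]x, y]%classic + muG `]x, y]%classic)%E; last first.
    by symmetry; exact: measure_addE.
  have [xy|yx] := leP x y.
    rewrite /muF /muG /lebesgue_measure !ocE//= -EFinD.
    by congr EFin; rewrite /G; lra.
  by rewrite set_itv_ge ?bnd_simp -?leNgt ?ltW// /muF /muG !measure0 adde0.
have mab : measurable (`]a, b]%classic : set (measurableTypeR R)) by exact: measurable_itv.
have Fab : (muF `]a, b]%classic < +oo)%E by rewrite /muF ocE ?ltry ?ltW.
(* Restriction to []a, b]] makes the measure finite and lets integrals of its density from -oo start
   counting at [a]. *)
pose nu : {finite_measure set (measurableTypeR R) -> \bar R} := mfrestr mab Fab.
have dom : nu `<< leb.
  apply/null_content_dominatesP => A mA A0.
  have : (muF A + muG A = 0)%E.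
    by have := lebE _ mA; rewrite [X in X = _]A0 => ->; symmetry; exact: measure_addE.
  move=> /eqP; rewrite padde_eq0// => /andP[/eqP F0 _].
  apply/eqP; rewrite /nu /mfrestr /mrestr eq_le measure_ge0 andbT -F0.
  apply: (@le_measure _ _ _ (lebesgue_stieltjes_measure FC)) => //; rewrite inE //.
  exact: measurableI.
have [h [h0 hfin hint hE]] := @radon_nikodym_sigma_finite _ _ R (@lebesgue_measure R) nu dom.
exists (fine \o h).
  by apply: eq_integrable hint => // x _ /=; rewrite fineK.
move=> x /andP[ax xb].
rewrite /Rintegral (eq_integral h); last by move=> t _ /=; rewrite fineK.
rewrite -hE//= /nu /mfrestr /mrestr.
have -> : `]-oo, x]%classic `&` `]a, b]%classic = `]a, x]%classic :> set R.
  apply/seteqP; split => t /=; rewrite !in_itv/=.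
    by move=> [-> /andP[-> _]].
  by move=> /andP[-> tx]; split => //; rewrite (le_trans tx xb).
by rewrite /muF ocE.
Qed.

End lipschitz_ftc.

#[global] Instance leb_ae_filter (R : realType) :
  Filter (nbhs (almost_everywhere (@lebesgue_measure R))).
Proof. exact: ae_filter_ringOfSetsType. Qed.

#[global] Instance leb2_ae_filter (R : realType) :
  Filter (nbhs (almost_everywhere
    (@lebesgue_measure R \x @lebesgue_measure R)%E)).
Proof. exact: ae_filter_ringOfSetsType. Qed.

(** * Derivatives in increment form *)

Section pointwise_derivative.
Context {R : realType}.
Implicit Types (F G : R -> R) (x l m : R).

(** The increment form includes the existence of the derivative, which an equation for [derive1]
    does not because of its default value, and it avoids divisions. *)
Definition deriv_at F x l := forall e, 0 < e ->
  exists2 d, 0 < d & forall h, `|h| < d -> `|F (x + h) - F x - l * h| <= e * `|h|.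

Lemma deriv_atP F x l : deriv_at F x l <-> derivable F x 1 /\ derive1 F x = l.
Proof.
have qE h : h != 0 -> `|l - h^-1 *: (F (h *: 1 + x) - F x)| =
    `|F (x + h) - F x - l * h| / `|h|.
  move=> h0; rewrite -normfV -normrM -normrN; congr `|_|.
  rewrite /GRing.scale/= mulr1 (addrC h x); field.
  by [].
have limP : deriv_at F x l <-> h^-1 *: (F (h *: 1 + x) - F x) @[h --> 0^'] --> l.
  split.
    move=> dF; apply/cvgrPdist_le => e e0; have [d d0 dh] := dF e e0.
    near=> h.
    have h0 : h != 0 by near: h; exact: nbhs_dnbhs_neq.
    rewrite qE// ler_pdivrMr ?normr_gt0//; apply: dh.
    by near: h; apply: dnbhs0_lt.
  move=> /cvgrPdist_le cF e e0; have := cF e e0.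
  rewrite near_withinE/= => /nbhs_ballP[d/= d0 dh]; exists d => // h hd.
  have [->|h0] := eqVneq h 0; first by rewrite mulr0 addr0 subrr subr0 normr0 mulr0.
  have := dh h; rewrite /ball/= sub0r normrN => /(_ hd h0).
  by rewrite qE// ler_pdivrMr ?normr_gt0.
have dE : derive1 F x = lim (h^-1 *: (F (h *: 1 + x) - F x) @[h --> 0^']).
  rewrite derive1E /derive; congr (lim _).
split.
  move=> /limP cF; split; first by apply/cvg_ex; exists l.
  by rewrite dE; apply/cvg_lim.
move=> [dF lE]; apply/limP; rewrite -lE dE; exact: dF.
Unshelve. all: by end_near. Qed.

Lemma deriv_at_derive1 F x : derivable F x 1 -> deriv_at F x (derive1 F x).
Proof. by move=> dF; apply/deriv_atP. Qed.

(** The additive constant serves integrals of a density, which recover a function only up to its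
    value at the left end. *)
Lemma deriv_at_near F G x l c d : 0 < d ->
  (forall h, `|h| < d -> F (x + h) = G (x + h) + c) ->
  deriv_at G x l -> deriv_at F x l.
Proof.
move=> d0 FG dG e e0; have [d' d'0 dh] := dG e e0.
exists (Num.min d d'); first by rewrite lt_min d0.
move=> h; rewrite lt_min => /andP[hd hd'].
have := FG 0; rewrite normr0 addr0 => /(_ d0) ->.
rewrite FG// (_ : _ - _ - _ = G (x + h) - G x - l * h); first exact: dh.
by ring.
Qed.

Lemma deriv_atD F G x l m : deriv_at F x l -> deriv_at G x m ->
  deriv_at (fun y => F y + G y) x (l + m).
Proof.
move=> /deriv_atP[dF lF] /deriv_atP[dG lG]; apply/deriv_atP; split.
  exact: derivableD.
by rewrite derive1E deriveD// -!derive1E lF lG.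
Qed.

Lemma deriv_atN F x l : deriv_at F x l -> deriv_at (fun y => - F y) x (- l).
Proof.
move=> /deriv_atP[dF lF]; apply/deriv_atP; split; first exact: derivableN.
by rewrite derive1E deriveN// -!derive1E lF.
Qed.

Lemma deriv_atB F G x l m : deriv_at F x l -> deriv_at G x m ->
  deriv_at (fun y => F y - G y) x (l - m).
Proof. by move=> dF dG; apply: deriv_atD => //; exact: deriv_atN. Qed.

Lemma deriv_atM F G x l m : deriv_at F x l -> deriv_at G x m ->
  deriv_at (fun y => F y * G y) x (l * G x + F x * m).
Proof.
move=> /deriv_atP[dF lF] /deriv_atP[dG lG]; apply/deriv_atP; split.
  exact: derivableM.
rewrite derive1E deriveM// -!derive1E lF lG /GRing.scale/=; ring.
Qed.

Lemma deriv_at_ge0 F x l : {homo F : x y / x <= y} -> deriv_at F x l -> 0 <= l.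
Proof.
move=> ndF dF; rewrite leNgt; apply/negP => l0.
have [|d d0 dh] := dF (- l / 2); first by rewrite divr_gt0 ?oppr_gt0.
have d2 : 0 < d / 2 by rewrite divr_gt0.
have := dh (d / 2); rewrite gtr0_norm// => /(_ ltac:(lra)).
have : F x <= F (x + d / 2) by apply: ndF; rewrite lerDl ltW.
move=> Fx; have ld : l * (d / 2) < 0 by rewrite pmulr_llt0.
rewrite ger0_norm; last by rewrite subr_ge0 (le_trans (ltW ld))// subr_ge0.
lra.
Qed.

Lemma deriv_at_norm_le F x l K : 0 <= K ->
  (exists2 d, 0 < d & forall h, `|h| < d -> `|F (x + h) - F x| <= K * `|h|) ->
  deriv_at F x l -> `|l| <= K.
Proof.
move=> K0 [d d0 FK] dF; apply/ler_addgt0Pr => e e0.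
have [d' d'0 dh] := dF e e0.
pose h := Num.min d d' / 2.
have h0 : 0 < h by rewrite divr_gt0// lt_min d0.
have hm : h < Num.min d d' by rewrite /h ltr_pdivrMr// ltr_pMr ?ltr1n// lt_min d0.
move: hm; rewrite lt_min => /andP[hd hd'].
have := FK h; have := dh h; rewrite (gtr0_norm h0) => /(_ hd') A /(_ hd) B.
rewrite -(ler_pM2r h0) -[X in `|l| * X](gtr0_norm h0) -normrM.
rewrite (_ : l * h = (F (x + h) - F x) - (F (x + h) - F x - l * h)); last by ring.
by rewrite (le_trans (ler_normB _ _))// mulrDl lerD.
Qed.

End pointwise_derivative.

(** * Fundamental theorem of calculus for Lipschitz functions *)

Section lipschitz_ftc_general.
Context {R : realType}.
Implicit Types (F h k : R -> R) (a b K : R).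

Lemma lip_density K F a b : lip K F -> a < b ->
  exists2 h, leb.-integrable [set: R] (EFin \o h) &
    forall x, a <= x <= b -> \int[leb]_(t in `]-oo, x]) h t = F x - F a.
Proof.
move=> lF ab.
(* Adding [k * x] makes [F] nondecreasing with slopes at most [2 * k], and dividing by [c] brings
   them below 1; the extra 1 keeps [c] positive when [K = 0]. *)
pose k := `|K|; pose c := 2 * k + 1.
have k0 : 0 <= k by exact: normr_ge0.
have c0 : 0 < c by rewrite /c; lra.
have lk x y : `|F x - F y| <= k * `|x - y|.
  by rewrite (le_trans (lF x y))// ler_wpM2r// ler_norm.
pose F1 x := (F x + k * x) / c.
have nd1 : {homo F1 : x y / x <= y}.
  move=> x y xy; rewrite /F1 ler_pM2r ?invr_gt0//.
  have := lk x y; rewrite distrC (distrC x) (ger0_norm (x := y - x)) ?subr_ge0//.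
  by rewrite ler_norml => /andP[+ _]; lra.
have l1 : lip 1 F1.
  move=> x y; rewrite /F1 mul1r -mulrBl normrM normfV (gtr0_norm c0) ler_pdivrMr//.
  rewrite (_ : _ - _ = (F x - F y) + k * (x - y)); last by ring.
  rewrite (le_trans (ler_normD _ _))// normrM (ger0_norm k0).
  have := lk x y; have := normr_ge0 (x - y).
  rewrite /c; move: `|x - y| `|F x - F y| => p q p0 qp.
  nra.
have [h1 ih1 h1E] := nd_lip1_density nd1 l1 ab.
pose I : R -> R := \1_(`]a, b]%classic).
have iI : leb.-integrable [set: R] (EFin \o I).
  exact: integrable_indic_itv.
have S (x : R) : `]-oo, x]%classic `<=` [set: R] by [].
have mx (x : R) : measurable (`]-oo, x]%classic : set R) by exact: measurable_itv.
have ich1 : leb.-integrable [set: R] (EFin \o (fun x => c * h1 x)).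
  by apply: eq_integrable (integrableZl measurableT c ih1).
have ikI : leb.-integrable [set: R] (EFin \o (fun x => k * I x)).
  by apply: eq_integrable (integrableZl measurableT k iI).
exists (fun x => c * h1 x - k * I x).
  by apply: eq_integrable (integrableB measurableT ich1 ikI).
move=> x /andP[ax xb].
rewrite RintegralB//; last 2 first.
- exact: integrableS ich1.
- exact: integrableS ikI.
rewrite !RintegralZl//; last 2 first.
- exact: integrableS iI.
- exact: integrableS ih1.
rewrite h1E ?ax//.
have -> : \int[leb]_(t in `]-oo, x]) I t = x - a.
  rewrite /Rintegral integral_indic//=.
  have -> : `]a, b]%classic `&` `]-oo, x]%classic = `]a, x]%classic :> set R.
    apply/seteqP; split => t /=; rewrite !in_itv/=.
      by move=> [/andP[-> _] ->].
    by move=> /andP[-> tx]; split => //; rewrite (le_trans tx xb).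
  rewrite [X in fine X](_ : _ = (x - a)%:E)//.
  rewrite lebesgue_measure_itv/= lte_fin.
  by move: ax; rewrite le_eqVlt => /predU1P[->|->]; rewrite ?ltxx ?subrr.
rewrite /F1; field; lra.
Qed.

(** Lebesgue differentiation of the integral of [h], which near each interior point is [F] up to a
    constant. *)
Lemma density_deriv_at h F a b : leb.-integrable [set: R] (EFin \o h) ->
  (forall x, a <= x <= b -> \int[leb]_(t in `]-oo, x]) h t = F x - F a) ->
  {ae leb, forall x, a < x < b -> deriv_at F x (h x)}.
Proof.
move=> ih hE.
have lh : locally_integrable [set: R] h.
  by rewrite -[h](patch_setT (fun=> 0)); exact: integrable_locally.
have ihS (y : R) : leb.-integrable `]-oo, y]%classic (EFin \o h).
  by apply: integrableS ih => //; exact: measurable_itv.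
have := FTC1Ny ihS lh; apply: filterS.
move=> x /deriv_atP dx /andP[ax xb].
apply: (@deriv_at_near _ _ _ _ _ (F a) (Num.min (x - a) (b - x))) dx.
  by rewrite lt_min !subr_gt0 ax.
move=> e; rewrite lt_min !ltr_norml => /andP[/andP[e1 e2] /andP[e3 e4]].
by rewrite hE ?subrK//; apply/andP; split; lra.
Qed.

Lemma lip_ae_derivable K F : lip K F -> {ae leb, forall x, derivable F x 1}.
Proof.
move=> lF.
have H (n : nat) : {ae leb, forall x, - n.+1%:R < x < n.+1%:R -> derivable F x 1}.
  have [|h ih hE] := lip_density lF (_ : - n.+1%:R < n.+1%:R).
    by rewrite gtrN.
  have := density_deriv_at ih hE; apply: filterS.
  by move=> x dx xn; have /deriv_atP[] := dx xn.
have := ae_foralln H; apply: filterS => x dx.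
apply: (dx (Num.truncn `|x|)).
by rewrite -ltr_norml truncnS_gt.
Qed.

(** Leaving [k] free lets [hj_solution], absolute values and product-rule expressions stand for the
    derivative directly, each with its own proof of measurability. *)
Lemma lip_integral K F k a b : lip K F -> a <= b ->
  measurable_fun `[a, b] k ->
  {ae leb, forall x, a < x < b -> derivable F x 1 -> k x = derive1 F x} ->
  (\int[leb]_(x in `[a, b]) (k x)%:E = (F b - F a)%:E)%E.
Proof.
move=> lF; rewrite le_eqVlt => /predU1P[->|ab] mk kF.
  by rewrite subrr set_itv1 integral_set1.
have [h ih hE] := lip_density lF ab.
have mkoo : measurable_fun `]a, b[ (EFin \o k).
  apply/measurable_EFinP; apply: measurable_funS mk => //.
  exact: subset_itv_oo_cc.
have ihoo : leb.-integrable `]a, b[ (EFin \o h).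
  exact: integrableS ih.
have ihoc : leb.-integrable `]a, b] (EFin \o h).
  exact: integrableS ih.
have ihNy : leb.-integrable `]-oo, b] (EFin \o h).
  exact: integrableS ih.
rewrite integral_itv_bndoo//.
rewrite (ae_eq_integral (EFin \o h))//; last 2 first.
- by case/integrableP : ihoo.
- have := density_deriv_at ih hE; apply: filterS2 kF => x kx dx /=.
  rewrite in_itv/= => xab; have /deriv_atP[d1 d2] := dx xab.
  by rewrite kx// d2.
rewrite -(@integral_itv_bndoo _ _ _ _ false false); last by case/integrableP : ihoo.
rewrite -[LHS]fineK; last exact: integrable_fin_num.
congr EFin.
have := @Rintegral_itvB _ h -oo%O (BRight b) a ihNy isT.
rewrite bnd_simp (ltW ab) => /(_ isT) E.
rewrite -[LHS]E !hE ?lexx ?ltW//.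
by rewrite subrr subr0.
Qed.

End lipschitz_ftc_general.

(** * Convexity, superlinear growth and Fenchel duality *)

Section convex_functions.
Context {R : realType}.
Implicit Types (f g : R -> R).

Definition cvx g := forall x y t, 0 <= t <= 1 ->
  g (t * x + (1 - t) * y) <= t * g x + (1 - t) * g y.

(** A minorant valid on the whole line for every slope, rather than a limit at infinity: it is
    applied at unknown points, and it passes to the Fenchel dual. *)
Definition superlin g := forall M, exists C, forall p, M * `|p| - C <= g p.

Lemma convex_function_cvx f :
  convex_function (E := R^o) [set: R^o] f -> cvx f.
Proof.
move=> cf x y t /andP[t0 t1].
have i01 : Itv.spec (@Itv.num_sem R) (Itv.Real `[0%Z, 1%Z]) t.
  by apply/and3P; split; rewrite ?num_real//= in_itv/= t0 t1.
by have := cf (Itv.mk i01) x y (in_setT _) (in_setT _).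
Qed.

Lemma cvx3 g x y z : cvx g -> x <= y <= z ->
  (z - x) * g y <= (z - y) * g x + (y - x) * g z.
Proof.
move=> cg /andP[xy yz].
have [zx|zx] := eqVneq x z.
  have -> : y = x by apply/le_anti; rewrite xy zx yz.
  by rewrite -zx; lra.
have xz : 0 < z - x by rewrite subr_gt0 lt_neqAle zx (le_trans xy yz).
pose t := (z - y) / (z - x).
have t01 : 0 <= t <= 1.
  apply/andP; split; first by rewrite /t divr_ge0//; lra.
  by rewrite /t ler_pdivrMr// mul1r; lra.
have := cg x z t t01.
have -> : t * x + (1 - t) * z = y by rewrite /t; field; lra.
rewrite -(ler_pM2l xz) => /le_trans; apply.
rewrite le_eqVlt; apply/orP; left; apply/eqP.
by rewrite /t; field; lra.
Qed.

(** With equal sums, [b] and [c] are symmetric in [[a, d]], so their weights on the chord are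
    swapped; adding the two chord bounds leaves the sum of the end values. *)
Lemma cvx4 g a b c d : cvx g -> a <= b <= d -> a + d = b + c ->
  g b + g c <= g a + g d.
Proof.
move=> cg /andP[ab bd] E.
have [ad|ad] := eqVneq a d.
  have bE : b = d by apply/le_anti; rewrite bd -ad.
  by have -> : c = a; [lra|rewrite bE; lra].
have da : 0 < d - a by rewrite subr_gt0 lt_neqAle ad (le_trans ab bd).
have abd : a <= b <= d by rewrite ab bd.
have acd : a <= c <= d by apply/andP; split; lra.
rewrite -(ler_pM2l da) mulrDr.
have := cvx3 cg abd; have := cvx3 cg acd.
have -> : c = a + d - b by lra.
lra.
Qed.

Lemma cvx_le_max g A p : cvx g -> `|p| <= A -> g p <= Num.max (g A) (g (- A)).
Proof.
move=> cg; rewrite ler_norml => /andP[p1 p2].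
have [A0|A0] := eqVneq A 0.
  have -> : p = A by lra.
  by rewrite le_max lexx.
have A1 : 0 < A by move: A0 => /eqP; lra.
set M := Num.max _ _.
have gA : g A <= M by rewrite le_max lexx.
have gnA : g (- A) <= M by rewrite le_max lexx orbT.
have := @cvx3 g (- A) p A cg; rewrite p1 p2 => /(_ isT).
nra.
Qed.

(** Convexity at the midpoint 0 of [p] and [- p] turns the upper bound at [- p] into a lower bound
    at [p]. *)
Lemma cvx_ge g A p : cvx g -> `|p| <= A ->
  g 0 *+ 2 - Num.max (g A) (g (- A)) <= g p.
Proof.
move=> cg pA; have pA' : `|- p| <= A by rewrite normrN.
have := cvx_le_max cg pA'.
have h01 : 0 <= (1 / 2 : R) <= 1 by apply/andP; split; lra.
have := cg p (- p) (1 / 2) h01.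
have -> : 1 / 2 * p + (1 - 1 / 2) * - p = 0 by field.
lra.
Qed.

(** The two limits control [f] only outside a bounded interval; inside it the lower bound comes from
    convexity. *)
Lemma superlinear_superlin f : cvx f -> superlinear f -> superlin f.
Proof.
move=> cf [/cvgryPge fy /cvgryPge fNy] M.
have [A [A0 AM]] : exists A, 0 <= A /\ forall p, A < `|p| -> M * `|p| <= f p.
  have /= [A1 [_ h1]] := fy M; have /= [A2 [_ h2]] := fNy M.
  exists (Num.max `|A1| `|A2|); split; first by rewrite le_max normr_ge0.
  move=> p; rewrite gt_max => /andP[p1 p2].
  have p0 : 0 < `|p| by rewrite (le_lt_trans _ p1).
  rewrite -ler_pdivlMr//.
  have [pp|pn] := leP 0 p.
    by apply: h1; rewrite (le_lt_trans (ler_norm _))// -(ger0_norm pp).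
  apply: h2; rewrite -ltrN2 -(ltr0_norm pn) (le_lt_trans _ p2)//.
  by rewrite -normrN ler_norm.
exists (`|M| * A + `|f 0 *+ 2 - Num.max (f A) (f (- A))|) => p.
have [pA|pA] := leP `|p| A.
  apply: le_trans (cvx_ge cf pA).
  have : M * `|p| <= `|M| * A.
    by rewrite (le_trans (ler_norm _))// normrM normr_id ler_wpM2l.
  have := ler_norm (- (f 0 *+ 2 - Num.max (f A) (f (- A)))).
  by rewrite normrN; lra.
apply: le_trans (AM _ pA).
have : 0 <= `|M| * A by rewrite mulr_ge0.
have := normr_ge0 (f 0 *+ 2 - Num.max (f A) (f (- A))).
lra.
Qed.

(** Slopes within [[- A, A]] are bounded by those of chords reaching to [A + 1] or [- (A + 1)],
    whose length is at least 1. *)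
Lemma cvx_locally_lipschitz g A : cvx g -> exists2 L, 0 <= L &
  forall x y, `|x| <= A -> `|y| <= A -> `|g x - g y| <= L * `|x - y|.
Proof.
move=> cg.
pose m := Num.max (g (A + 1)) (g (- (A + 1))).
(* On [[- (A + 1), A + 1]] the values of [g] lie between [g 0 *+ 2 - m] and [m], so [L] bounds the
   oscillation there. *)
pose L := (m - g 0) + (m - g 0).
have key x y : `|x| <= A -> `|y| <= A -> x <= y -> `|g x - g y| <= L * (y - x).
  move=> xA yA xy.
  have xA1 : `|x| <= A + 1 by lra.
  have yA1 : `|y| <= A + 1 by lra.
  have := cvx_ge cg xA1; have := cvx_ge cg yA1.
  have := cvx_le_max cg xA1; have := cvx_le_max cg yA1.
  rewrite -/m => ym xm mx my.
  have gA : g (A + 1) <= m by rewrite le_max lexx.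
  have gnA : g (- (A + 1)) <= m by rewrite le_max lexx orbT.
  move: xA yA; rewrite !ler_norml => /andP[x1 x2] /andP[y1 y2].
  have := @cvx3 g x y (A + 1) cg; rewrite xy (_ : y <= A + 1); last by lra.
  move=> /(_ isT) U.
  have := @cvx3 g (- (A + 1)) x y cg; rewrite xy (_ : _ <= x); last by lra.
  move=> /(_ isT) D.
  rewrite /L; apply/andP; split.
    have : (g y - g x) * (A + 1 - y) <= (m - g 0 + (m - g 0)) * (y - x) by nra.
    have [gyx|gyx] := leP 0 (g y - g x); last by nra.
    nra.
  have : (g x - g y) * (x + (A + 1)) <= (m - g 0 + (m - g 0)) * (y - x) by nra.
  have [gyx|gyx] := leP 0 (g x - g y); last by nra.
  nra.
have [A0|A0] := leP 0 A; last first.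
  by exists 0 => // x y xA; have := normr_ge0 x; lra.
exists L.
  have : g 0 <= m by apply: cvx_le_max => //; rewrite normr0; lra.
  by rewrite /L; lra.
move=> x y xA yA; have [xy|yx] := leP x y.
  by have := key x y xA yA xy; rewrite (distrC x) (ger0_norm (x := y - x))// subr_ge0.
have := key y x yA xA (ltW yx).
by rewrite (distrC (g y)) (ger0_norm (x := x - y))// subr_ge0 ltW.
Qed.

Lemma cvx_continuous g : cvx g -> continuous g.
Proof.
move=> cg x; have [L L0 gL] := cvx_locally_lipschitz (`|x| + 1) cg.
apply/cvgrPdist_le => e e0; near=> y.
have xy : `|x - y| <= e / (L + 1).
  by near: y; apply: cvgr_dist_le; [exact: cvg_id|apply: divr_gt0 => //; lra].
have xy1 : `|x - y| <= 1 by near: y; apply: cvgr_dist_le; [exact: cvg_id|].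
have yx : `|y| <= `|x| + 1.
  by rewrite -[y](subKr x) (le_trans (ler_normB _ _))// lerD2l.
rewrite (le_trans (gL _ _ _ yx)) ?lerDl//.
rewrite ler_pdivlMr in xy; last by lra.
by have := normr_ge0 (x - y); nra.
Unshelve. all: by end_near. Qed.

(** Every slope to the left of [p] is at most every slope to the right, so the supremum of the left
    slopes serves as [q]. *)
Lemma cvx_subgradient f p : cvx f ->
  exists q, forall p', f p + q * (p' - p) <= f p'.
Proof.
move=> cf; pose S := [set (f p - f p') / (p - p') | p' in [set p' | p' < p]].
have ubS r : p < r -> ubound S ((f r - f p) / (r - p)).
  move=> pr _ [p' /= p'p <-].
  rewrite ler_pdivrMr ?subr_gt0// mulrAC ler_pdivlMr ?subr_gt0//.
  have ppr : p' <= p <= r by rewrite (ltW p'p) (ltW pr).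
  by have := cvx3 cf ppr; lra.
have S0 : S !=set0 by exists ((f p - f (p - 1)) / (p - (p - 1))), (p - 1) => //=; lra.
exists (sup S) => p'.
have [pp'|pp'|->] := ltgtP p p'; last by rewrite subrr mulr0 addr0.
  rewrite -lerBrDl -ler_pdivlMr ?subr_gt0//; apply: ge_sup => //; exact: ubS.
have : (f p - f p') / (p - p') <= sup S.
  apply: ub_le_sup; last by exists p'.
  by exists ((f (p + 1) - f p) / (p + 1 - p)); apply: ubS; lra.
rewrite ler_pdivrMr ?subr_gt0//; lra.
Qed.

(** Superlinearity bounds the set in [fenchel], so that its [sup] is a true supremum and not a
    default value. *)
Lemma fenchel_ge f p q : superlin f -> p * q - f p <= fenchel f q.
Proof.
move=> sf; apply: ub_le_sup; last by exists p.
have [C fC] := sf `|q|; exists C => _ [r _ <-].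
have := fC r; have := ler_norm (r * q); rewrite normrM mulrC; lra.
Qed.

Lemma fenchel_le f q M : (forall p, p * q - f p <= M) -> fenchel f q <= M.
Proof.
move=> fM; apply: ge_sup; last by move=> _ [p _ <-]; exact: fM.
by exists (0 * q - f 0), 0.
Qed.

Lemma fenchel_cvx f : superlin f -> cvx (fenchel f).
Proof.
move=> sf x y t /andP[t0 t1]; apply: fenchel_le => p.
have := fenchel_ge p x sf; have := fenchel_ge p y sf.
nra.
Qed.

(** Test the supremum at [M] or [- M], according to the sign of [q]. *)
Lemma fenchel_superlin f : superlin f -> superlin (fenchel f).
Proof.
move=> sf M; exists (Num.max (f M) (f (- M))) => q.
have [q0|q0] := leP 0 q.
  have := fenchel_ge M q sf; rewrite ger0_norm//.
  have : f M <= Num.max (f M) (f (- M)) by rewrite le_max lexx.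
  lra.
have := fenchel_ge (- M) q sf; rewrite ltr0_norm//.
have : f (- M) <= Num.max (f M) (f (- M)) by rewrite le_max lexx orbT.
lra.
Qed.

(** A subgradient of [f] at [p] is such a [q]. Together with [fenchel_ge] this recovers [f p] as the
    largest value of [p * q - fenchel f q]. *)
Lemma fenchel_attained f p : cvx f -> exists q, fenchel f q <= p * q - f p.
Proof.
move=> cf; have [q fq] := cvx_subgradient p cf; exists q.
by apply: fenchel_le => p'; have := fq p'; lra.
Qed.

End convex_functions.

(** * The Hopf-Lax formula *)

Section hopf_lax_formula.
Context {R : realType}.
Implicit Types (f g w : R -> R) (x y t h p q e C K L : R).

(** With [fenchel f] for [g] and [primitive u0] for [w] this is [hj_value f u0 (x, t)] by
    conversion. A free [g] isolates the arguments that use only its convexity and growth. *)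
Definition hopf_lax g w x t : R :=
  inf [set w y + t * g ((x - y) / t) | y in [set: R]].

(* Covers both primitives of bounded functions ([C = 0]) and primitives of
   integrable functions ([K = 0]). *)
Definition coarse_lip C K w := forall x y, `|w x - w y| <= C + K * `|x - y|.

(** Growth of [g] at slope [K] compensates the linear part of the variation of [w]; this makes the
    [inf] in [hopf_lax] a true infimum. *)
Lemma hopf_lax_lb g w x t C K : superlin g -> coarse_lip C K w -> 0 < t ->
  exists m, forall y, m <= w y + t * g ((x - y) / t).
Proof.
move=> sg gw t0; have [D gD] := sg K.
exists (w x - C - t * D) => y.
have := gw x y; rewrite ler_norml => /andP[_ wxy].
have := gD ((x - y) / t); rewrite normrM normfV (gtr0_norm t0) -(ler_pM2l t0).
have -> : t * (K * (`|x - y| / t) - D) = K * `|x - y| - t * D by field; lra.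
lra.
Qed.

Lemma hopf_lax_le g w x t C K y : superlin g -> coarse_lip C K w -> 0 < t ->
  hopf_lax g w x t <= w y + t * g ((x - y) / t).
Proof.
move=> sg gw t0; apply: ge_inf; last by exists y.
have [m hm] := hopf_lax_lb x sg gw t0.
by exists m => _ [z _ <-].
Qed.

Lemma hopf_lax_ge g w x t m : (forall y, m <= w y + t * g ((x - y) / t)) ->
  m <= hopf_lax g w x t.
Proof.
move=> hm; apply: lb_le_inf; last by move=> _ [z _ <-].
by exists (w 0 + t * g ((x - 0) / t)), 0.
Qed.

Lemma hopf_lax_near g w x t C K e : superlin g -> coarse_lip C K w -> 0 < t ->
  0 < e -> exists y, w y + t * g ((x - y) / t) < hopf_lax g w x t + e.
Proof.
move=> sg gw t0 e0.
have hi : has_inf [set w y + t * g ((x - y) / t) | y in [set: R]].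
  split; first by exists (w 0 + t * g ((x - 0) / t)), 0.
  have [m hm] := hopf_lax_lb x sg gw t0.
  by exists m => _ [z _ <-].
have [_ [y _ <-] yV] := inf_adherent e0 hi.
by exists y.
Qed.

(** The near-minimizer of [w1] at [y] is reused for [w2] at [y], and that of [w2] at [x] for [w1] at
    [x]: the kinetic terms cancel and only the data remain. *)
Lemma hopf_lax_osc g w1 w2 x y t C1 K1 C2 K2 I : superlin g ->
  coarse_lip C1 K1 w1 -> coarse_lip C2 K2 w2 -> 0 < t ->
  (forall z z', (w2 z' - w1 z') - (w2 z - w1 z) <= I) ->
  (hopf_lax g w2 y t - hopf_lax g w1 y t) -
  (hopf_lax g w2 x t - hopf_lax g w1 x t) <= I.
Proof.
move=> sg g1 g2 t0 osc; apply/ler_addgt0Pr => e e0.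
have e2 : 0 < e / 2 by lra.
have [z1 h1] := hopf_lax_near y sg g1 t0 e2.
have [z2 h2] := hopf_lax_near x sg g2 t0 e2.
have := hopf_lax_le x z2 sg g1 t0; have := hopf_lax_le y z1 sg g2 t0.
have := osc z2 z1; lra.
Qed.

(* The eps-minimizers y1 for w1 at x1 and y2 for w2 at x2 are exchanged: when
   y1 <= y2 only the data change hands, and otherwise convexity of g controls
   the exchange of the kinetic terms. *)
Lemma hopf_lax_comparison g w1 w2 t C1 K1 C2 K2 : cvx g -> superlin g ->
  coarse_lip C1 K1 w1 -> coarse_lip C2 K2 w2 -> 0 < t ->
  {homo (fun y => w2 y - w1 y) : x y / x <= y} ->
  {homo (fun x => hopf_lax g w2 x t - hopf_lax g w1 x t) : x y / x <= y}.
Proof.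
move=> cg sg g1 g2 t0 nd x1 x2 x12.
suff : hopf_lax g w1 x2 t + hopf_lax g w2 x1 t <=
       hopf_lax g w2 x2 t + hopf_lax g w1 x1 t by lra.
apply/ler_addgt0Pr => e e0.
have e2 : 0 < e / 2 by lra.
have [y1 h1] := hopf_lax_near x1 sg g1 t0 e2.
have [y2 h2] := hopf_lax_near x2 sg g2 t0 e2.
have [y12|y21] := leP y1 y2.
  have := nd _ _ y12; have := hopf_lax_le x2 y2 sg g1 t0.
  have := hopf_lax_le x1 y1 sg g2 t0.
  lra.
have := hopf_lax_le x2 y1 sg g1 t0; have := hopf_lax_le x1 y2 sg g2 t0.
have D (z y : R) : y < z -> y / t < z / t by move=> yz; rewrite ltr_pM2r ?invr_gt0.
have abd : (x1 - y1) / t <= (x2 - y1) / t <= (x2 - y2) / t.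
  by rewrite !ler_pM2r ?invr_gt0//; apply/andP; split; lra.
have := cvx4 (c := (x1 - y2) / t) cg abd ltac:(rewrite -!mulrDl; congr (_ / t); ring).
rewrite -(ler_pM2l t0) !mulrDr.
lra.
Qed.

(** Compared with the competitor [x] itself, growth of [g] at slope [K + 1] leaves a spare [t * q]
    after paying for the variation of [w]. Dividing by [t] bounds the speed [q]; the constant
    [C + 1] then appears divided by [t], whence the restriction to [t0 <= t]. *)
Lemma near_minimizer_slope g w C K t0 : superlin g -> coarse_lip C K w -> 0 < t0 ->
  exists Q, forall x t y, t0 <= t ->
    w y + t * g ((x - y) / t) <= hopf_lax g w x t + 1 -> `|(x - y) / t| <= Q.
Proof.
move=> sg gw t00; have [D gD] := sg (K + 1).
exists (`|C + 1| / t0 + g 0 + D) => x t y t0t hy.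
have tpos : 0 < t by lra.
have := hopf_lax_le x x sg gw tpos; rewrite subrr mul0r => V0.
have := gw x y; rewrite ler_norml => /andP[_ wxy].
have := gD ((x - y) / t); set q := `|_ / t| => gq.
have xy : `|x - y| = t * q.
  by rewrite /q normrM normfV (gtr0_norm tpos); field; lra.
rewrite xy in wxy.
have gqt : t * ((K + 1) * q - D) <= t * g ((x - y) / t) by rewrite ler_pM2l.
have Ct : `|C + 1| <= t * (`|C + 1| / t0).
  by rewrite -{1}(divfK (lt0r_neq0 t00) `|C + 1|) mulrC ler_wpM2r// divr_ge0// ltW.
rewrite -(ler_pM2l tpos) (mulrDr t) (mulrDr t).
have := ler_norm (C + 1); lra.
Qed.

(** Two points of the line are joined by equally spaced points at mutual distance at most [d], along
    which the local bounds add up without loss. *)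
Lemma lip_chain w L d : 0 < d ->
  (forall x y, `|x - y| <= d -> `|w x - w y| <= L * `|x - y|) -> lip L w.
Proof.
move=> d0 Lw.
have H n : forall x y, `|x - y| <= n.+1%:R * d -> `|w x - w y| <= L * `|x - y|.
  elim: n => [x y|n IH x y]; first by rewrite mul1r; exact: Lw.
  move=> xy; pose a : R := n.+2%:R; have a0 : 0 < a by rewrite ltr0n.
  have na : n.+1%:R = a - 1 by rewrite /a -[in RHS]addn1 natrD addrK.
  pose z := x + (y - x) / a.
  have xz : `|x - z| = `|x - y| / a.
    have -> : x - z = (x - y) / a by rewrite /z; field; lra.
    by rewrite normrM normfV (gtr0_norm a0).
  have zy : `|z - y| = `|x - y| / a * (a - 1).
    have a1 : 0 <= a - 1 by rewrite -na.
    have -> : z - y = (x - y) / a * (a - 1) by rewrite /z; field; lra.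
    by rewrite 2!normrM normfV (gtr0_norm a0) (ger0_norm a1).
  have xya : `|x - y| / a <= d by rewrite ler_pdivrMr// mulrC.
  have := Lw x z; rewrite xz => /(_ xya).
  have := IH z y; rewrite zy na mulrC ler_wpM2l//; last by rewrite -na.
  move=> /(_ isT) A B.
  rewrite (_ : w x - w y = (w x - w z) + (w z - w y)); last by ring.
  rewrite (le_trans (ler_normD _ _))// (le_trans (lerD B A))// -mulrDr.
  rewrite le_eqVlt; apply/orP; left; apply/eqP; congr (_ * _); field; lra.
move=> x y; apply: (H (Num.truncn (`|x - y| / d))).
by rewrite -ler_pdivrMr// ltW// truncnS_gt.
Qed.

(** A near-minimizer for [y] is kept as competitor for [x]. Only the kinetic term changes: its slope
    stays in an interval where [g] is Lipschitz, and the factor [t] cancels the division by [t] in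
    the slope. *)
Lemma hopf_lax_lip g w C K t0 : cvx g -> superlin g -> coarse_lip C K w -> 0 < t0 ->
  exists2 L, 0 <= L & forall t, t0 <= t -> lip L (hopf_lax g w ^~ t).
Proof.
move=> cg sg gw t00; have [Q hQ] := near_minimizer_slope sg gw t00.
have [L L0 gL] := cvx_locally_lipschitz (Q + 1) cg.
exists L => // t t0t; have tpos : 0 < t by lra.
suff H x y : `|x - y| <= t0 -> hopf_lax g w x t - hopf_lax g w y t <= L * `|x - y|.
  apply: (lip_chain t00) => x y xy; rewrite ler_norml; apply/andP; split.
    by rewrite lerNl opprB distrC; apply: H; rewrite distrC.
  exact: H.
move=> xy; apply/ler_addgt0Pr => e e0.
(* [near_minimizer_slope] accepts an excess of at most 1, while the conclusion allows [e]. *)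
have e1 : 0 < Num.min e 1 by rewrite lt_min e0 ltr01.
have [z hz] := hopf_lax_near y sg gw tpos e1.
have zQ : `|(y - z) / t| <= Q.
  by apply: hQ => //; rewrite (le_trans (ltW hz))// lerD2l ge_min lexx orbT.
have := hopf_lax_le x z sg gw tpos.
have dE : (x - z) / t - (y - z) / t = (x - y) / t by field; lra.
have xyt : `|x - y| / t <= 1 by rewrite ler_pdivrMr// mul1r; lra.
have xQ : `|(x - z) / t| <= Q + 1.
  rewrite -[_ / t](subrK ((y - z) / t)) dE (le_trans (ler_normD _ _))// addrC lerD//.
  by rewrite normrM normfV (gtr0_norm tpos).
have yQ : `|(y - z) / t| <= Q + 1 by lra.
have := gL _ _ xQ yQ; rewrite dE normrM normfV (gtr0_norm tpos).
move=> /(le_trans (ler_norm _)); rewrite -(ler_pM2l tpos).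
have -> : t * (L * (`|x - y| / t)) = L * `|x - y| by field; lra.
have : Num.min e 1 <= e by rewrite ge_min lexx.
move: (g _) (g _) hz => g1 g2 hz; lra.
Qed.

(** The slope from [z] to [x] is the average, weighted by the durations, of the slopes from [z] to
    [y] and from [y] to [x]; convexity of [g] compares the costs. *)
Lemma hopf_lax_semigroup_le g w C K x y t h : cvx g -> superlin g -> coarse_lip C K w ->
  0 < t -> 0 < h ->
  hopf_lax g w x (t + h) <= hopf_lax g w y t + h * g ((x - y) / h).
Proof.
move=> cg sg gw t0 h0; have th : 0 < t + h by lra.
rewrite -lerBlDr; apply: hopf_lax_ge => z.
have := hopf_lax_le x z sg gw th.
have s01 : 0 <= t / (t + h) <= 1.
  apply/andP; split; first by rewrite divr_ge0 ?ltW.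
  by rewrite ler_pdivrMr// mul1r lerDl ltW.
have := cg ((y - z) / t) ((x - y) / h) _ s01.
have -> : t / (t + h) * ((y - z) / t) + (1 - t / (t + h)) * ((x - y) / h) = (x - z) / (t + h).
  by field; rewrite !gt_eqF.
set g1 := g ((y - z) / t); set g2 := g ((x - y) / h) => cgt V.
have : (t + h) * g ((x - z) / (t + h)) <= t * g1 + h * g2; last by lra.
apply: (le_trans (ler_wpM2l (ltW th) cgt)); rewrite le_eqVlt; apply/orP; left.
by apply/eqP; field; rewrite gt_eqF.
Qed.

(** The intermediate point is taken on the straight path from the near-minimizer to [x]: both legs
    have slope [q], so the cost splits exactly. *)
Lemma hopf_lax_semigroup_near g w C K x t h e : cvx g -> superlin g -> coarse_lip C K w ->
  0 < t -> 0 < h -> 0 < e -> exists q,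
  hopf_lax g w (x - h * q) t + h * g q < hopf_lax g w x (t + h) + e.
Proof.
move=> cg sg gw t0 h0 e0; have th : 0 < t + h by lra.
have [z hz] := hopf_lax_near x sg gw th e0.
exists ((x - z) / (t + h)); apply: le_lt_trans hz.
have := hopf_lax_le (x - h * ((x - z) / (t + h))) z sg gw t0.
have -> : (x - h * ((x - z) / (t + h)) - z) / t = (x - z) / (t + h).
  by field; rewrite !gt_eqF.
lra.
Qed.

(** From above, staying at [x] costs [h * g 0]. From below, moving at speed [q] lowers the value by
    at most [L * h] times the modulus of [q], which growth of [g] at slope [L] repays up to
    [h * D]. *)
Lemma hopf_lax_time_lip g w C K t0 : cvx g -> superlin g -> coarse_lip C K w -> 0 < t0 ->
  exists2 B, 0 <= B & forall x t h, t0 <= t -> 0 < h ->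
    `|hopf_lax g w x (t + h) - hopf_lax g w x t| <= B * h.
Proof.
move=> cg sg gw t00; have [L L0 hL] := hopf_lax_lip cg sg gw t00.
have [D gD] := sg L.
exists (`|g 0| + `|D|) => [|x t h t0t h0]; first by rewrite addr_ge0.
have tpos : 0 < t by lra.
rewrite ler_norml; apply/andP; split; last first.
  have := hopf_lax_semigroup_le x x cg sg gw tpos h0; rewrite subrr mul0r.
  have := ler_norm (g 0); have := normr_ge0 D; nra.
apply/ler_addgt0Pr => e e0.
have [q hq] := hopf_lax_semigroup_near x cg sg gw tpos h0 e0.
have := hL _ t0t x (x - h * q); rewrite (_ : x - (x - h * q) = h * q); last by ring.
rewrite normrM (gtr0_norm h0) => /(le_trans (ler_norm _)).
have := gD q; have := ler_norm D; have := normr_ge0 (g 0).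
move: `|q| (g q) hq => q' gq hq; nra.
Qed.

(** By the semigroup property the increment over time [h] is, to first order, [h] times the infimum
    over [q] of [g q - p * q]. That this is [- f p] is [fenchel_ge] from below and
    [fenchel_attained] from above. *)
Lemma hopf_lax_time_derivative f w C K x t p : cvx f -> superlin f ->
  coarse_lip C K w -> 0 < t -> deriv_at (hopf_lax (fenchel f) w ^~ t) x p ->
  forall e, 0 < e -> exists2 d, 0 < d & forall h, 0 < h < d ->
    `|hopf_lax (fenchel f) w x (t + h) - hopf_lax (fenchel f) w x t + h * f p| <= e * h.
Proof.
move=> cf sf gw t0 dV e e0.
have cg := fenchel_cvx sf; have sg := fenchel_superlin sf.
set g := fenchel f in dV cg sg *.
have [L L0 hL] := hopf_lax_lip cg sg gw t0.
have [D gD] := sg (L + 1).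
have [q0 hq0] := fenchel_attained p cf.
(* [Q] dominates the optimal speed [q0] and also the speeds of near-minimizers, which growth of [g]
   at slope [L + 1] confines. *)
pose Q := `|q0| + `|D + g 0 + 1|.
have Q0 : 0 <= Q by rewrite addr_ge0.
(* A share [e' * Q] pays for the expansion of the value in [x], one more [e'] for the excess of the
   near-minimizer; [e' <= 1] is used in bounding its speed. *)
pose e' := Num.min (e / (Q + 1)) 1.
have e'0 : 0 < e' by rewrite lt_min ltr01 divr_gt0//; lra.
have e'1 : e' <= 1 by rewrite ge_min lexx orbT.
have e'e : e' * (Q + 1) <= e.
  by rewrite -ler_pdivlMr; [rewrite ge_min lexx|lra].
have [d d0 hd] := dV e' e'0.
exists (d / (Q + 1)); first by rewrite divr_gt0//; lra.
move=> h /andP[h0 hdQ].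
have key q : `|q| <= Q -> `|hopf_lax g w (x - h * q) t - hopf_lax g w x t + h * q * p|
    <= e' * Q * h.
  move=> qQ; have := hd (- (h * q)).
  rewrite normrN normrM (gtr0_norm h0) => H.
  rewrite ltr_pdivlMr in hdQ; last by lra.
  have hq : h * `|q| < d by nra.
  have := H hq; rewrite (_ : _ - p * _ =
    hopf_lax g w (x - h * q) t - hopf_lax g w x t + h * q * p); last by ring.
  by move=> /le_trans; apply; rewrite -mulrA ler_pM2l// mulrC ler_wpM2r// ltW.
rewrite ler_norml; apply/andP; split.
  have eh : 0 < e' * h by rewrite mulr_gt0.
  have [q hq] := hopf_lax_semigroup_near x cg sg gw t0 h0 eh.
  have qQ : `|q| <= Q.
    have := hL _ (lexx t) x (x - h * q).
    rewrite (_ : x - (x - h * q) = h * q); last by ring.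
    rewrite normrM (gtr0_norm h0) => /(le_trans (ler_norm _)).
    have := hopf_lax_semigroup_le x x cg sg gw t0 h0; rewrite subrr mul0r.
    have := gD q; have := ler_norm (D + g 0 + 1); have := normr_ge0 q0.
    rewrite /Q => A1 A2 A3 A4 A5.
    rewrite -(ler_pM2l h0).
    have A3h : h * ((L + 1) * `|q| - D) <= h * g q by rewrite ler_pM2l.
    have A2h : h * (D + g 0 + 1) <= h * `|D + g 0 + 1| by rewrite ler_pM2l.
    have A1h : 0 <= h * `|q0| by rewrite mulr_ge0// ltW.
    have : e' * h <= h by rewrite ler_piMl// ltW.
    rewrite !mulrDr; lra.
  have := key _ qQ; rewrite ler_norml => /andP[k1 _].
  have := fenchel_ge p q sf; rewrite -/g -(ler_pM2l h0) => fq.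
  have : e' * Q * h + e' * h <= e * h by rewrite -mulrDl ler_pM2r//; lra.
  lra.
have q0Q : `|q0| <= Q by rewrite /Q lerDl.
have := key _ q0Q; rewrite ler_norml => /andP[_ k1].
have := hopf_lax_semigroup_le x (x - h * q0) cg sg gw t0 h0.
rewrite (_ : (x - (x - h * q0)) / h = q0); last by field; lra.
move: hq0; rewrite -/g -(ler_pM2l h0) => hq0.
have : e' * Q * h <= e * h by rewrite ler_pM2r//; lra.
lra.
Qed.

Lemma hopf_lax_init g w C K x : cvx g -> superlin g -> coarse_lip C K w ->
  {for x, continuous w} -> forall e, 0 < e ->
  exists2 d, 0 < d & forall t, 0 < t < d -> `|hopf_lax g w x t - w x| <= e.
Proof.
move=> cg sg gw cw e e0.
have e2 : 0 < e / 2 by lra.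
have /cvgrPdist_le /(_ _ e2) /nbhs_ballP[r/= r0 wr] := cw.
(* At distance at least [r] this slope outweighs the linear part of the variation of [w] and its
   jump [C], and leaves 1 to absorb [t * D]. At smaller distances continuity of [w] suffices. *)
have [D gD] := sg ((C + 1) / r + K).
have [E gE] := sg 0.
pose B := `|D| + `|E| + `|g 0| + 1.
have B0 : 0 < B by rewrite /B; have := normr_ge0 D; have := normr_ge0 E; have := normr_ge0 (g 0); lra.
have [ED [EE Eg]] : [/\ D <= B, E <= B & g 0 <= B].
  have := normr_ge0 D; have := normr_ge0 E; have := normr_ge0 (g 0).
  have := ler_norm D; have := ler_norm E; have := ler_norm (g 0).
  by rewrite /B => *; split; lra.
exists (Num.min (e / 2 / B) (1 / B)); first by rewrite lt_min !divr_gt0.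
move=> t /andP[t0]; rewrite lt_min !ltr_pdivlMr// => /andP[te t1].
have tE : t * E <= t * B by rewrite ler_pM2l.
have tD : t * D <= t * B by rewrite ler_pM2l.
have tg : t * g 0 <= t * B by rewrite ler_pM2l.
have := hopf_lax_le x x sg gw t0; rewrite subrr mul0r => V0.
rewrite ler_norml; apply/andP; split; last by lra.
rewrite lerBrDl; apply: hopf_lax_ge => y.
have [xyr|rxy] := ltP `|x - y| r.
  have := wr y xyr; rewrite ler_norml => /andP[_ wxy].
  have := gE ((x - y) / t); rewrite mul0r -(ler_pM2l t0); lra.
have := gw x y; rewrite ler_norml => /andP[_ wxy].
have := gD ((x - y) / t); rewrite normrM normfV (gtr0_norm t0) -(ler_pM2l t0).
have -> : t * (((C + 1) / r + K) * (`|x - y| / t) - D) =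
   (C + 1) * (`|x - y| / r) + K * `|x - y| - t * D by field; rewrite !gt_eqF.
have C0 : 0 <= C by have := gw 0 0; rewrite !subrr !normr0 mulr0 addr0.
have : 1 <= `|x - y| / r by rewrite ler_pdivlMr// mul1r.
have : 0 <= (C + 1) * (`|x - y| / r - 1).
  by rewrite mulr_ge0 ?subr_ge0 ?ler_pdivlMr ?mul1r//; lra.
lra.
Qed.

End hopf_lax_formula.

(** * Measurability in the plane *)

Section plane_measurability.
Context {R : realType}.
Implicit Types (A D : set (R * R)) (G : R * R -> R) (z : R * R).

(** The boxes with rational centres and radii [n.+1%:R^-1] contained in an open set are countably
    many and cover it. *)
Lemma open_measurable2 A : open A -> measurable A.
Proof.
move=> oA.
pose B (p q : rat) (n : nat) : set (R * R) :=
  ball (ratr p : R) n.+1%:R^-1 `*` ball (ratr q : R) n.+1%:R^-1.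
pose C p q n := if asbool (B p q n `<=` A) then B p q n else set0.
have -> : A = \bigcup_p \bigcup_q \bigcup_n C p q n.
  apply/seteqP; split => z; last first.
    by move=> [p _ [q _ [n _]]]; rewrite /C; case: asboolP => // BA /BA.
  move=> Az; have /nbhs_ballP[e/= e0 zA] : nbhs z A by exact: open_nbhs_nbhs.
  pose n := Num.truncn (2 / e).
  have n0 : 0 < n.+1%:R^-1 :> R by rewrite invr_gt0.
  have ne : n.+1%:R^-1 < e / 2.
    by rewrite invf_plt ?posrE ?divr_gt0// invf_div truncnS_gt.
  have H (a : R) : exists p, ball (ratr p : R) n.+1%:R^-1 a.
    have /rat_in_itvoo[p /itvP pa] : a < a + n.+1%:R^-1 by rewrite ltrDl.
    exists p; rewrite /ball/= ger0_norm; last by rewrite subr_ge0 ltW// pa.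
    by rewrite ltrBlDl pa.
  have [p pz] := H z.1; have [q qz] := H z.2.
  exists p => //; exists q => //; exists n => //; rewrite /C asboolT; first by split.
  have ne2 : n.+1%:R^-1 + n.+1%:R^-1 <= e.
    by rewrite [leRHS]splitr lerD// ltW.
  move=> y [/= y1 y2]; apply: zA; split.
    have := ball_triangle (ball_sym pz) y1; exact: le_ball.
  have := ball_triangle (ball_sym qz) y2; exact: le_ball.
apply: bigcupT_measurable_rat => p; apply: bigcupT_measurable_rat => q.
apply: bigcupT_measurable => n; rewrite /C; case: asboolP => // _.
by apply: measurableX; exact: measurable_ball.
Qed.

Lemma closed_measurable2 A : closed A -> measurable A.
Proof. by move/closed_openC/open_measurable2/measurableC; rewrite setCK. Qed.

Lemma open_continuous_measurable_fun2 D G : open D ->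
  (forall z, D z -> {for z, continuous G}) -> measurable_fun D G.
Proof.
move=> oD cG; apply: (measurability _ (RGenOpens.measurableE R)).
move=> _ [_ [a [b ->] <-]]; apply: open_measurable2.
rewrite openE => z [Dz Gz]; apply: filterI; first exact: open_nbhs_nbhs.
by apply: cG => //; apply: open_nbhs_nbhs; split => //; exact: interval_open.
Qed.

Lemma halfplane_open : open (@halfplane R).
Proof.
have -> : @halfplane R = snd @^-1` `]0, +oo[%classic.
  by apply/seteqP; split => z /=; [case|].
apply: open_comp; first by move=> z _; exact: cvg_snd.
exact: interval_open.
Qed.

Lemma halfplaneP z : halfplane z <-> 0 < z.2.
Proof.
by rewrite /halfplane/=; split => [[_]|z0]; rewrite ?in_itv/= ?andbT//; split => //; rewrite in_itv/= andbT.
Qed.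

(** By the Cauchy criterion for difference quotients the derivative exists on a measurable set.
    There it is a limit of continuous functions; elsewhere it has a constant default value. *)
Lemma measurable_partial_x G : (forall z, halfplane z -> {for z, continuous G}) ->
  measurable_fun halfplane (partial_x G).
Proof.
move=> cG; pose Q h z := (G (z.1 + h, z.2) - G z) / h.
have cQ h z : halfplane z -> {for z, continuous (Q h)}.
  move=> Hz; apply: cvgM; last exact: cvg_cst.
  apply: cvgB; last exact: cG.
  have Hz' : halfplane (z.1 + h, z.2) by move/halfplaneP : Hz => Hz; apply/halfplaneP.
  have cs : (y.1 + h, y.2) @[y --> z] --> (z.1 + h, z.2).
    apply: (@cvg_pair _ _ _ (nbhs z) (nbhs (z.1 + h)) (nbhs z.2)); last exact: cvg_snd.
    by apply: cvgD; [exact: cvg_fst|exact: cvg_cst].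
  exact: cvg_comp cs (cG _ Hz').
have derivE z : derivable (fun x => G (x, z.2)) z.1 1 = cvg (Q h z @[h --> 0^']).
  rewrite /derivable (_ : (fun h => _) = Q ^~ z)//; apply/funext => h.
  by rewrite /Q /GRing.scale/= mulr1 mulrC (addrC h) -surjective_pairing.
have derive1E' z : partial_x G z = lim (Q h z @[h --> 0^']).
  rewrite /partial_x /derive1 (_ : (fun h => _) = Q ^~ z)//; apply/funext => h.
  by rewrite /Q /GRing.scale/= mulrC (addrC h) -surjective_pairing.
pose small n (h : R) := 0 < `|h| < n.+1%:R^-1.
(* The steps [h] and [h'] range over uncountably many reals, but each pair gives an open condition,
   so the union is still open. *)
pose Bad k n := [set z | halfplane z /\ exists h h', [/\ small n h, small n h' &
  k.+1%:R^-1 < `|Q h z - Q h' z|]].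
have oBad k n : open (Bad k n).
  rewrite openE => z [Hz [h [h' [sh sh' kz]]]].
  have : nbhs z halfplane by apply: open_nbhs_nbhs; split => //; exact: halfplane_open.
  have : \forall y \near z, k.+1%:R^-1 < `|Q h y - Q h' y|.
    have cn : {for z, continuous (fun y => `|Q h y - Q h' y|)}.
      by apply: cvg_norm; apply: cvgB; exact: cQ.
    by apply: (cvgr_gt _ cn).
  by apply: filterS2 => y ky Hy; split => //; exists h, h'.
pose E := \bigcap_k \bigcup_n (halfplane `\` Bad k n).
have mH : measurable (@halfplane R) by apply: open_measurable2; exact: halfplane_open.
have mE : measurable E.
  apply: bigcapT_measurable => k; apply: bigcupT_measurable => n.
  by apply: measurableD => //; exact: open_measurable2.
have EH : E `<=` halfplane by move=> z /(_ 0%N I)[n _ []].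
have EP z : halfplane z -> (E z <-> cvg (Q h z @[h --> 0^'])).
  move=> Hz; split.
    move=> Ez; apply/cauchy_cvgP/cauchy_ballP => e e0.
    have [n _ [_ nB]] := Ez (Num.truncn e^-1) I.
    pose U := [set h | small n h].
    have nU : \forall h \near 0^', U h.
      near=> h; apply/andP; split.
        by rewrite normr_gt0; near: h; exact: nbhs_dnbhs_neq.
      by near: h; apply: dnbhs0_lt; rewrite invr_gt0.
    exists (Q ^~ z @` U, Q ^~ z @` U).
      by split; apply: filterS nU => h Uh; exists h.
    move=> [_ _] [/= [h Uh <-] [h' Uh' <-]].
    rewrite /ball/=; apply: (@le_lt_trans _ _ ((Num.truncn e^-1).+1%:R^-1)).
      rewrite leNgt; apply/negP => lt; apply: nB; split => //.
      by exists h, h'.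
    by rewrite invf_plt ?posrE// truncnS_gt.
  move=> /cvg_ex[l /cvgrPdist_lt Ql] k _.
  have k0 : 0 < k.+1%:R^-1 / 2 :> R by rewrite divr_gt0// invr_gt0.
  have := Ql _ k0; rewrite near_withinE => /nbhs_ballP[d/= d0 dQ].
  exists (Num.truncn d^-1) => //; split => // -[_ [h [h' [/andP[h0 hd] /andP[h'0 h'd]]]]].
  have dn : (Num.truncn d^-1).+1%:R^-1 < d by rewrite invf_plt ?posrE// truncnS_gt.
  have H x : 0 < `|x| -> `|x| < (Num.truncn d^-1).+1%:R^-1 -> `|l - Q x z| < k.+1%:R^-1 / 2.
    move=> x0 xd; apply: dQ; last by rewrite -normr_gt0.
    by rewrite /ball/= sub0r normrN (lt_trans xd).
  have := H _ h0 hd; have := H _ h'0 h'd => A B.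
  apply/negP; rewrite -leNgt.
  rewrite (_ : Q h z - Q h' z = (l - Q h' z) - (l - Q h z)); last by ring.
  by rewrite (le_trans (ler_normB _ _))// [leRHS]splitr lerD// ltW.
have -> : @halfplane R = E `|` (halfplane `\` E) by rewrite setDUK.
apply/measurable_funU => //; first exact: measurableD.
split.
  apply: (@measurable_fun_cvg _ _ _ _ (fun n => Q n.+1%:R^-1)).
    move=> n; apply: (measurable_funS mH EH).
    by apply: open_continuous_measurable_fun2 => //; [exact: halfplane_open|exact: cQ].
  move=> z Ez; have /EP := EH _ Ez; rewrite derive1E' => -[/(_ Ez) cz _].
  apply: (cvgr_dnbhsP _ _ _).1 cz _ _; split; last exact: cvg_harmonic.
  by move=> n; rewrite invr_neq0.
apply: (@eq_measurable_fun _ _ _ _ _ (cst point)).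
  move=> z /[!inE] -[Hz nEz]; rewrite derive1E' /=.
  by apply/esym/dvgP => cz; apply: nEz; apply/EP.
exact: measurable_cst.
Unshelve. all: by end_near. Qed.

End plane_measurability.

(** * Primitives of bounded and of integrable data *)

Section primitives.
Context {R : realType}.
Implicit Types (u w : R -> R) (a b x y K : R).

Definition itv_integrable u := forall a b, leb.-integrable `[a, b] (EFin \o u).

Lemma L1_itv_integrable u : L1 leb setT u -> itv_integrable u.
Proof. by move=> iu a b; apply: integrableS iu. Qed.

Lemma LooP u : Loo leb setT u ->
  measurable_fun setT u /\ exists2 K, 0 <= K & \forall x \ae leb, `|u x| <= K.
Proof.
rewrite /Loo patch_setT => uL.
have := sub_Lfun_mfun uL; rewrite inE/= => mu.
have := sub_Lfun_finLfun uL; rewrite inE/=.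
rewrite /finite_norm unlock /Lnorm.
have -> : (0 < leb [set: R])%E.
  rewrite -set_itvNyy lebesgue_measure_itv/= addye// lt0y.
move=> uoo; have [M uM] := @ess_supr_bounded _ _ _ leb (fun x => `|u x|) uoo.
split => //.
exists (Num.max M 0); first by rewrite le_max lexx orbT.
by apply: filterS uM => x /= uM; rewrite le_max uM.
Qed.

Lemma leb_itvcc a b : a <= b -> leb (`[a, b]%classic : set R) = (b - a)%:E.
Proof.
rewrite lebesgue_measure_itv/= lte_fin le_eqVlt => /predU1P[->|->//].
by rewrite ltxx subrr.
Qed.

Lemma ae_bounded_itv_integral u K a b : measurable_fun `[a, b] u -> 0 <= K ->
  (\forall x \ae leb, a <= x <= b -> `|u x| <= K) -> a <= b ->
  (\int[leb]_(x in `[a, b]) `|u x|%:E <= (K * (b - a))%:E)%E.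
Proof.
move=> mu K0 uK ab.
have mn : measurable_fun `[a, b] (fun x => `|u x|) by exact: measurableT_comp.
(* Truncation at [K] changes the integrand on a null set only and makes the bound hold
   everywhere. *)
rewrite (ae_eq_integral (EFin \o (fun x : measurableTypeR R => Num.min `|u x| K)))//.
- apply: (@le_trans _ _ (\int[leb]_(x in `[a, b]) (cst K%:E) x)%E).
    apply: ge0_le_integral => //.
    + by move=> x _; rewrite lee_fin le_min normr_ge0.
    + by apply/measurable_EFinP; apply: measurable_minr.
    + by move=> x _; rewrite lee_fin ge_min lexx orbT.
  by rewrite integral_cst// EFinM -leb_itvcc.
- exact/measurable_EFinP.
- by apply/measurable_EFinP; apply: measurable_minr.
- by apply: filterS uK => x xK /=; rewrite in_itv/= => xab; rewrite min_l// xK.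
Qed.

Lemma ae_bounded_integrable u K a b : measurable_fun `[a, b] u -> 0 <= K ->
  (\forall x \ae leb, a <= x <= b -> `|u x| <= K) ->
  leb.-integrable `[a, b] (EFin \o u).
Proof.
move=> mu K0 uK; have [ab|ba] := leP a b; last first.
  by rewrite set_itv_ge ?bnd_simp -?ltNge//; exact: integrable_set0.
apply/integrableP; split; first exact/measurable_EFinP.
exact: le_lt_trans (ae_bounded_itv_integral mu K0 uK ab) (ltry _).
Qed.

Lemma ae_bounded_Rintegral u K a b : measurable_fun `[a, b] u -> 0 <= K ->
  (\forall x \ae leb, a <= x <= b -> `|u x| <= K) -> a <= b ->
  `|\int[leb]_(x in `[a, b]) u x| <= K * (b - a).
Proof.
move=> mu K0 uK ab; have iu := ae_bounded_integrable mu K0 uK.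
rewrite -lee_fin EFin_normr_Rintegral//.
apply: le_trans (ae_bounded_itv_integral mu K0 uK ab).
by apply: le_abse_integral => //; case/integrableP : iu.
Qed.

Lemma Loo_itv_integrable u : Loo leb setT u -> itv_integrable u.
Proof.
move=> /LooP[mu [K K0 uK]] a b.
apply: (ae_bounded_integrable (measurable_funTS mu) K0).
by apply: filterS uK.
Qed.

Lemma primitive_diff u a b : itv_integrable u -> a <= b ->
  primitive u b - primitive u a = \int[leb]_(x in `[a, b]) u x.
Proof.
move=> iu ab.
have S x y z : x <= y -> y <= z ->
    \int[leb]_(s in `[x, z]) u s = \int[leb]_(s in `[x, y]) u s + \int[leb]_(s in `[y, z]) u s.
  move=> xy yz; have := @Rintegral_itvB _ u (BLeft x) (BRight z) y (iu x z).
  rewrite !bnd_simp => /(_ xy yz) E.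
  rewrite -(@Rintegral_itv_obnd_cbnd _ y); last first.
    by apply: integrableS (iu y z) => //; exact: subset_itv_oc_cc.
  by rewrite -E addrC subrK.
rewrite /primitive; case: (leP 0 b) => b0; case: (leP 0 a) => a0.
- by rewrite (S 0 a b)// addrC addKr.
- by rewrite opprK addrC -S// ltW.
- by have := le_lt_trans ab b0; rewrite ltNge a0.
- by rewrite (S a b 0)//; [ring|exact: ltW].
Qed.

Lemma primitive_diff_norm u a b : itv_integrable u -> a <= b ->
  (`|primitive u b - primitive u a|%:E <= \int[leb]_(x in `[a, b]) `|u x|%:E)%E.
Proof.
move=> iu ab; rewrite primitive_diff// EFin_normr_Rintegral//.
by apply: le_abse_integral => //; case/integrableP : (iu a b).
Qed.

Lemma primitive_L1 u : L1 leb setT u -> exists C, coarse_lip C 0 (primitive u).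
Proof.
move=> iu; have ii := L1_itv_integrable iu.
exists (fine (\int[leb]_x `|u x|%:E)%E) => x y.
wlog yx : x y / y <= x.
  by move=> H; case/orP : (le_total y x) => [/H//|/H]; rewrite distrC (distrC x y).
rewrite mul0r addr0 -lee_fin.
have fi : (\int[leb]_x `|u x|%:E)%E \is a fin_num.
  rewrite ge0_fin_numE; last by apply: integral_ge0 => z _; rewrite lee_fin.
  by case/integrableP : iu.
rewrite fineK// (le_trans (primitive_diff_norm ii yx))//.
apply: ge0_subset_integral => //.
by have /integrable_abse/integrableP[] := iu.
Qed.

Lemma primitive_Loo u : Loo leb setT u -> exists K, coarse_lip 0 K (primitive u).
Proof.
move=> bu; have ii := Loo_itv_integrable bu.
have [mu [K K0 uK]] := LooP bu.
exists K => x y; wlog yx : x y / y <= x.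
  by move=> H; case/orP : (le_total y x) => [/H//|/H]; rewrite distrC (distrC x y).
rewrite add0r -lee_fin (le_trans (primitive_diff_norm ii yx))//.
rewrite ger0_norm ?subr_ge0//.
by apply: ae_bounded_itv_integral => //; [exact: measurable_funTS|exact: filterS uK].
Qed.

(** Near [x] the primitive is a constant plus the integral from the fixed point [x - 1], which is
    continuous in its upper end. *)
Lemma primitive_continuous u : itv_integrable u -> continuous (primitive u).
Proof.
move=> iu x; pose a := x - 1; pose b := x + 1.
have ab : a <= b by rewrite /a /b; lra.
have xab : x \in `]a, b[ by rewrite in_itv/= /a /b; apply/andP; split; lra.
have ab' : a < b by rewrite /a /b; lra.
have [+ _ _] := (continuous_within_itvP _ ab').1 (parameterized_integral_continuous ab (iu a b)).
move=> /(_ x xab) cx.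
have : {for x, continuous (fun y => primitive u a + parameterized_integral leb a y u)}.
  by apply: cvgD; [exact: cvg_cst|exact: cx].
rewrite /continuous_at -[X in _ --> X -> _](_ : primitive u x = _); last first.
  by rewrite /parameterized_integral -primitive_diff ?subrKC// /a; lra.
apply: cvg_trans; apply: near_eq_cvg.
have : \forall y \near x, a <= y.
  by near=> y; apply: ltW; near: y; apply: lt_nbhsr; rewrite /a; lra.
apply: filterS => y ay.
by rewrite /parameterized_integral -primitive_diff ?subrKC.
Unshelve. all: by end_near. Qed.

Lemma primitive_nd u1 u2 : itv_integrable u1 -> itv_integrable u2 ->
  (\forall x \ae leb, u1 x <= u2 x) ->
  {homo (fun x => primitive u2 x - primitive u1 x) : x y / x <= y}.
Proof.
move=> i1 i2 u12 x y xy; rewrite -subr_ge0.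
have -> : primitive u2 y - primitive u1 y - (primitive u2 x - primitive u1 x) =
    (primitive u2 y - primitive u2 x) - (primitive u1 y - primitive u1 x) by ring.
rewrite !primitive_diff// -RintegralB//.
have iB : leb.-integrable `[x, y] (fun z => (u2 z - u1 z)%:E).
  by apply: eq_integrable (integrableB _ (i2 x y) (i1 x y)).
have mB : measurable_fun `[x, y] (fun z => u2 z - u1 z).
  by apply/measurable_EFinP; case/integrableP : iB.
rewrite fine_ge0// (ae_eq_integral (EFin \o (fun z : measurableTypeR R => Num.max (u2 z - u1 z) 0))) => //.
- by apply: integral_ge0 => z _; rewrite lee_fin le_max lexx orbT.
- exact/measurable_EFinP.
- by apply/measurable_EFinP; exact: (measurable_maxr mB (@measurable_cst _ _ _ _ _ (0 : R))).
- by apply: filterS u12 => z z12 _ /=; rewrite max_l// subr_ge0.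
Qed.

End primitives.

(** * Null sets and integrals by time slices *)

Section slices.
Context {R : realType}.
Implicit Types (A : set R) (S : set (R * R)) (P : R * R -> Prop) (h : R * R -> \bar R).

(** The product measure is built from the sections at fixed [x]; uniqueness of product measures
    gives access to those at fixed [t]. *)
Lemma leb2_ysection S : measurable S ->
  leb2 S = (\int[leb]_t leb (ysection S t))%E.
Proof.
move=> mS; transitivity ((@lebesgue_measure R \x^ @lebesgue_measure R)%E S) => //.
by apply: product_measure_unique => //= *; rewrite product_measure2E.
Qed.

(** The exceptional set has null slices, and Tonelli makes it null because it is measurable, which
    the second hypothesis secures. *)
Lemma ae2_slices A P : measurable A -> measurable [set z | A z.2 /\ P z] ->
  (forall t, A t -> \forall x \ae leb, P (x, t)) ->
  \forall z \ae leb2, A z.2 -> P z.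
Proof.
move=> mA mP aeP; pose N := ([set: R] `*` A) `\` [set z | A z.2 /\ P z].
have mN : measurable N by apply: measurableD => //; exact: measurableX.
exists N; split => //; last first.
  by move=> z /= /not_implyP[Az nPz]; split => // -[].
rewrite leb2_ysection// integral0_eq// => t _.
have [At|nAt] := pselect (A t); last first.
  rewrite (_ : ysection N t = set0) ?measure0//.
  apply/seteqP; split => x //=; rewrite /ysection/= inE => -[[_ /=] //].
have [M [mM M0 MP]] := aeP t At.
apply: (subset_measure0 _ mM _ M0); first exact: measurable_ysection.
move=> x; rewrite /ysection/= inE => -[_ nP]; apply: MP => /= Px; exact: nP.
Qed.

Lemma slices_ae2 P : (\forall z \ae leb2, P z) ->
  \forall t \ae leb, \forall x \ae leb, P (x, t).
Proof.
move=> [N [mN N0 PN]].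
have : (\int[leb]_t `|leb (ysection N t)| = 0)%E.
  rewrite (_ : (\int[leb]_t _)%E = (\int[leb]_t leb (ysection N t))%E).
    by rewrite -leb2_ysection.
  by apply: eq_integral => t _; rewrite gee0_abs.
move=> /ae_eq_integral_abs; have mNs : measurable_fun [set: R] (fun t => leb (ysection N t)).
  exact: measurable_fun_ysection.
move=> /(_ measurableT mNs); apply: filterS => t /(_ I) Nt0.
exists (ysection N t); split => //; first exact: measurable_ysection.
by move=> x /= nPx; rewrite /ysection/= inE; apply: PN.
Qed.

Lemma measurable_slice (T : measurableType default_measure_display) A (h : R * R -> T) t : measurable A ->
  measurable_fun ([set: R] `*` A) h -> A t ->
  measurable_fun [set: R] (fun x => h (x, t)).
Proof.
move=> mA mh At.
apply: (@measurable_comp _ _ _ _ _ _ ([set: R] `*` A) h setT (fun x => (x, t))) => //.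
- exact: measurableX.
- by move=> _ [x _ <-]; exact: (conj I At).
Qed.

(** Both orders are needed: slice estimates integrate in [x] first, the contraction estimate of the
    theorem in [t] first. *)
Lemma strip_tonelli A h : measurable A -> measurable_fun ([set: R] `*` A) h ->
  (forall z, 0 <= h z)%E ->
  (\int[leb2]_(z in [set: R] `*` A) h z = \int[leb]_(t in A) \int[leb]_x h (x, t))%E /\
  (\int[leb2]_(z in [set: R] `*` A) h z = \int[leb]_x \int[leb]_(t in A) h (x, t))%E.
Proof.
move=> mA mh h0; have mTA : measurable ([set: R] `*` A) by exact: measurableX.
have mr : measurable_fun setT (h \_ ([set: R] `*` A)).
  by apply/(measurable_restrictT h mTA).
have r0 z : (0 <= (h \_ ([set: R] `*` A)) z)%E by exact: erestrict_ge0.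
have rE x t : (h \_ ([set: R] `*` A)) (x, t) = ((fun t => h (x, t)) \_ A) t.
  by rewrite !patchE; congr (if _ then _ else _); apply/idP/idP; rewrite !inE => //= -[].
split; rewrite integral_mkcond.
  have F2 := fubini_tonelli2 (m1 := @lebesgue_measure R) (m2 := @lebesgue_measure R) _ mr r0.
  rewrite F2 [RHS]integral_mkcond.
  apply: eq_integral => t _; rewrite /fubini_G/= [RHS]patchE.
  case: ifPn => tA; first by apply: eq_integral => x _; rewrite rE patchE tA.
  by apply: integral0_eq => x _; rewrite rE patchE (negbTE tA).
have F1 := fubini_tonelli1 (m1 := @lebesgue_measure R) (m2 := @lebesgue_measure R) _ mr r0.
rewrite F1; apply: eq_integral => x _.
by rewrite /fubini_F/= [RHS]integral_mkcond; apply: eq_integral => t _; rewrite rE.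
Qed.

End slices.

(** * HJ-solutions at a fixed time *)

Section hj_slices.
Context {R : realType}.
Variables (f : R -> R) (sf : superlin f).
Implicit Types (u : R -> R) (x t a b : R).

Let cg : cvx (fenchel f) := fenchel_cvx sf.
Let sg : superlin (fenchel f) := fenchel_superlin sf.

(** One class for bounded data, as in the comparison principle, and for integrable data, whose
    solutions are the limits in the other parts. *)
Definition admissible u :=
  itv_integrable u /\ exists C K, coarse_lip C K (primitive u).

Lemma L1_admissible u : L1 leb setT u -> admissible u.
Proof.
move=> iu; split; first exact: L1_itv_integrable.
by have [C uC] := primitive_L1 iu; exists C, 0.
Qed.

Lemma Loo_admissible u : Loo leb setT u -> admissible u.
Proof.
move=> bu; split; first exact: Loo_itv_integrable.
by have [K uK] := primitive_Loo bu; exists 0, K.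
Qed.

Lemma hj_lip u t0 : admissible u -> 0 < t0 ->
  exists2 L, 0 <= L & forall t, t0 <= t -> lip L (fun x => hj_value f u (x, t)).
Proof. by move=> [_ [C [K gw]]]; exact: hopf_lax_lip. Qed.

Lemma hj_continuous u z : admissible u -> halfplane z ->
  {for z, continuous (hj_value f u)}.
Proof.
move=> au /halfplaneP z0; have [_ [C [K gw]]] := au.
(* For times at least [z.2 / 2] the Lipschitz constants in space and in time are uniform. *)
have z20 : 0 < z.2 / 2 by rewrite divr_gt0.
have [L L0 hL] := hj_lip au z20.
have [B B0 hB] := hopf_lax_time_lip cg sg gw z20.
have tB s t : z.2 / 2 <= s -> z.2 / 2 <= t ->
    `|hj_value f u (z.1, s) - hj_value f u (z.1, t)| <= B * `|s - t|.
  wlog st : s t / s <= t.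
    move=> H zs zt; case/orP : (le_total s t) => st; first exact: H.
    by rewrite distrC (distrC s); exact: H.
  move=> zs zt; have [->|] := eqVneq s t; first by rewrite !subrr normr0 mulr0.
  move=> nst; have ts : 0 < t - s by rewrite subr_gt0 lt_neqAle nst.
  have := hB z.1 s _ zs ts; rewrite subrKC distrC => /le_trans; apply.
  by rewrite distrC gtr0_norm.
apply/cvgrPdist_le => e e0.
have LB0 : 0 < L + B + 1 by lra.
have d0 : 0 < e / (L + B + 1) by rewrite divr_gt0.
near=> y.
have y1 : `|z.1 - y.1| <= e / (L + B + 1).
  near: y; have : (fun y : R * R => y.1) @ z --> z.1 by exact: cvg_fst.
  by move=> /cvgrPdist_le; apply.
have y2 : `|z.2 - y.2| <= Num.min (e / (L + B + 1)) (z.2 / 2).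
  near: y; have : (fun y : R * R => y.2) @ z --> z.2 by exact: cvg_snd.
  by move=> /cvgrPdist_le; apply; rewrite lt_min d0 z20.
move: y2; rewrite le_min => /andP[y2 y2'].
have zy : z.2 / 2 <= y.2 by move: y2'; rewrite ler_norml; lra.
have := hL _ zy z.1 y.1; have := tB z.2 y.2 ltac:(lra) zy.
rewrite -!surjective_pairing => A1 A2.
rewrite (_ : hj_value f u z - hj_value f u y =
  (hj_value f u z - hj_value f u (z.1, y.2)) +
  (hj_value f u (z.1, y.2) - hj_value f u y)); last by ring.
rewrite (le_trans (ler_normD _ _))// (le_trans (lerD A1 A2))//.
have y1' : L * `|z.1 - y.1| <= L * (e / (L + B + 1)) by rewrite ler_wpM2l.
have y2'' : B * `|z.2 - y.2| <= B * (e / (L + B + 1)) by rewrite ler_wpM2l.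
have : (L + B) * (e / (L + B + 1)) <= e.
  rewrite mulrA ler_pdivrMr// mulrC ler_wpM2l ?ltW//; lra.
lra.
Unshelve. all: by end_near. Qed.

Lemma measurable_hj u : admissible u -> measurable_fun halfplane (hj_solution f u).
Proof. by move=> au; apply: measurable_partial_x => z; exact: hj_continuous. Qed.

Lemma measurable_hj_slice u t : admissible u -> 0 < t ->
  measurable_fun [set: R] (fun x => hj_solution f u (x, t)).
Proof.
move=> au t0; apply: (@measurable_slice _ _ `]0, +oo[ (hj_solution f u)) => //.
- exact: measurable_hj.
- by rewrite /= in_itv/= t0.
Qed.

Lemma hj_ae_deriv u t : admissible u -> 0 < t ->
  \forall x \ae leb, deriv_at (fun x => hj_value f u (x, t)) x (hj_solution f u (x, t)).
Proof.
move=> au t0; have [L _ /(_ t (lexx _)) hL] := hj_lip au t0.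
by have := lip_ae_derivable hL; apply: filterS => x /deriv_at_derive1.
Qed.

Lemma hj_integral u a b t : admissible u -> 0 < t -> a <= b ->
  (\int[leb]_(x in `[a, b]) (hj_solution f u (x, t))%:E =
   (hj_value f u (b, t) - hj_value f u (a, t))%:E)%E.
Proof.
move=> au t0 ab; have [L _ /(_ t (lexx _)) hL] := hj_lip au t0.
apply: (lip_integral (k := fun x => hj_solution f u (x, t)) hL ab).
  by apply: measurable_funTS; exact: measurable_hj_slice.
exact: aeW.
Qed.

Lemma hj_bound u t0 : admissible u -> 0 < t0 -> exists2 L, 0 <= L &
  forall t, t0 <= t -> \forall x \ae leb, `|hj_solution f u (x, t)| <= L.
Proof.
move=> au t00; have [L L0 hL] := hj_lip au t00.
exists L => // t t0t; have tpos : 0 < t by lra.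
have := hj_ae_deriv au tpos; apply: filterS => x dx.
apply: deriv_at_norm_le dx => //; exists 1 => // h _.
by have := hL _ t0t (x + h) x; have -> : x + h - x = h by ring.
Qed.

Lemma hj_diff_nd u1 u2 t : admissible u1 -> admissible u2 ->
  (\forall x \ae leb, u1 x <= u2 x) -> 0 < t ->
  {homo (fun x => hj_value f u2 (x, t) - hj_value f u1 (x, t)) : x y / x <= y}.
Proof.
move=> [i1 [C1 [K1 g1]]] [i2 [C2 [K2 g2]]] u12 t0.
exact: hopf_lax_comparison cg sg g1 g2 t0 (primitive_nd i1 i2 u12).
Qed.

Lemma hj_comparison_slice u1 u2 t : admissible u1 -> admissible u2 ->
  (\forall x \ae leb, u1 x <= u2 x) -> 0 < t ->
  \forall x \ae leb, hj_solution f u1 (x, t) <= hj_solution f u2 (x, t).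
Proof.
move=> a1 a2 u12 t0; have nd := hj_diff_nd a1 a2 u12 t0.
apply: filterS2 (hj_ae_deriv a1 t0) (hj_ae_deriv a2 t0) => x d1 d2.
by rewrite -subr_ge0; exact: deriv_at_ge0 nd (deriv_atB d2 d1).
Qed.

(** For ordered data the absolute value drops a.e. and the integrand is the derivative of the
    difference of the values. Its integral over [[- n, n]] is an increment, bounded by the
    oscillation [I] of the difference of the primitives; monotone convergence finishes. *)
Lemma hj_contraction_le u1 u2 t : L1 leb setT u1 -> L1 leb setT u2 ->
  (forall x, u1 x <= u2 x) -> 0 < t ->
  (\int[leb]_x `|hj_solution f u2 (x, t) - hj_solution f u1 (x, t)|%:E <=
   \int[leb]_x (u2 x - u1 x)%:E)%E.
Proof.
move=> l1 l2 u12 t0; have a1 := L1_admissible l1; have a2 := L1_admissible l2.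
have [i1 [C1 [K1 g1]]] := a1; have [i2 [C2 [K2 g2]]] := a2.
have m1 := measurable_hj_slice a1 t0; have m2 := measurable_hj_slice a2 t0.
have l12 : leb.-integrable setT (fun x => (u2 x - u1 x)%:E).
  by apply: eq_integrable (integrableB _ l2 l1).
have fI := integrable_fin_num measurableT l12.
have u12ae : \forall x \ae leb, u1 x <= u2 x by exact: aeW.
pose I := fine (\int[leb]_x (u2 x - u1 x)%:E).
have osc z z' : (primitive u2 z' - primitive u1 z') - (primitive u2 z - primitive u1 z) <= I.
  have -> : (primitive u2 z' - primitive u1 z') - (primitive u2 z - primitive u1 z) =
    (primitive u2 z' - primitive u2 z) - (primitive u1 z' - primitive u1 z) by ring.
  have I0 : 0 <= I.
    by rewrite fine_ge0// integral_ge0// => x _; rewrite lee_fin subr_ge0.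
  have [zz'|z'z] := leP z z'.
    rewrite !primitive_diff// -RintegralB// /I /Rintegral.
    have i12 : leb.-integrable `[z, z'] (fun x => (u2 x - u1 x)%:E).
      exact: integrableS l12.
    rewrite fine_le//; first exact: integrable_fin_num.
    apply: ge0_subset_integral => //; first by case/integrableP : l12.
    by move=> x _; rewrite lee_fin subr_ge0.
  have := primitive_nd i1 i2 u12ae (ltW z'z); lra.
have mD : measurable_fun setT
    (fun x => `|hj_solution f u2 (x, t) - hj_solution f u1 (x, t)|%:E).
  apply/measurable_EFinP.
  exact: (measurableT_comp (@normr_measurable R setT) (measurable_funB m2 m1)).
have cmp := hj_comparison_slice a1 a2 u12ae t0.
have itvB (n : nat) : (\int[leb]_(x in `[(- (n%:R : R))%R, (n%:R : R)%R])
    `|hj_solution f u2 (x, t) - hj_solution f u1 (x, t)|%:E <= I%:E)%E.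
  have n0 : - n%:R <= n%:R :> R by rewrite (le_trans _ (ler0n _ n))// oppr_le0.
  have [L1 _ /(_ t (lexx _)) hL1] := hj_lip a1 t0.
  have [L2 _ /(_ t (lexx _)) hL2] := hj_lip a2 t0.
  have hL : lip (L2 + L1) (fun x => hj_value f u2 (x, t) - hj_value f u1 (x, t)).
    move=> x y; have := hL1 x y; have := hL2 x y => A2 A1.
    rewrite (_ : _ - _ - _ = (hj_value f u2 (x, t) - hj_value f u2 (y, t)) -
      (hj_value f u1 (x, t) - hj_value f u1 (y, t))); last by ring.
    by rewrite (le_trans (ler_normB _ _))// mulrDl lerD.
  rewrite (lip_integral hL n0 (k := fun x => `|hj_solution f u2 (x, t) - hj_solution f u1 (x, t)|)).
  - rewrite lee_fin; exact: hopf_lax_osc sg g1 g2 t0 osc.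
  - by apply/measurable_EFinP; exact: measurable_funTS.
  - apply: filterS3 cmp (hj_ae_deriv a1 t0) (hj_ae_deriv a2 t0) => x c d1 d2 _ _.
    rewrite ger0_norm ?subr_ge0//.
    by have /deriv_atP[_ ->] := deriv_atB d2 d1.
rewrite -[leRHS]fineK// -/I.
pose F (n : nat) : set (measurableTypeR R) := `[- (n%:R : R), n%:R]%classic.
have mF n : measurable (F n) by exact: measurable_itv.
have ndF : nondecreasing_seq F.
  apply/nondecreasing_seqP => n; apply/subsetPset => x; rewrite /F/= !in_itv/=.
  have nS : n%:R <= n.+1%:R :> R by rewrite ler_nat.
  by move=> /andP[x1 x2]; rewrite (le_trans _ x1) ?lerN2//= (le_trans x2).
have cvgI := @ge0_nondecreasing_set_cvg_integral _ _ R F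
  (fun x => `|hj_solution f u2 (x, t) - hj_solution f u1 (x, t)|%:E) leb ndF mF
  (fun n => measurable_funTS mD) (fun _ _ _ => normr_ge0 _).
have FT : \bigcup_i F i = setT.
  apply/seteqP; split => // x _; exists (Num.truncn `|x|).+1 => //=.
  by rewrite /F/= in_itv/= -ler_norml ltW// truncnS_gt.
rewrite FT in cvgI; apply: (cvge_le _ cvgI).
by apply: nearW.
Qed.

(** Passing through [u3] costs nothing on the data: [(u3 x - u1 x) + (u3 x - u2 x)] is exactly the
    modulus of [u1 x - u2 x]. *)
Lemma hj_contraction_slice u1 u2 t : L1 leb setT u1 -> L1 leb setT u2 -> 0 < t ->
  (\int[leb]_x `|hj_solution f u1 (x, t) - hj_solution f u2 (x, t)|%:E <=
   \int[leb]_x `|u1 x - u2 x|%:E)%E.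
Proof.
move=> l1 l2 t0; pose u3 x := Num.max (u1 x) (u2 x).
have l12 : leb.-integrable setT (fun x => (u1 x - u2 x)%:E).
  by apply: eq_integrable (integrableB _ l1 l2).
have [mu1 mu2] : measurable_fun setT u1 /\ measurable_fun setT u2.
  by split; apply/measurable_EFinP; [case/integrableP : l1|case/integrableP : l2].
have l3 : L1 leb setT u3.
  have l' : leb.-integrable setT (fun x => (`|u1 x| + `|u2 x|)%:E).
    by apply: eq_integrable (integrableD _ (integrable_abse l1) (integrable_abse l2)).
  apply: (le_integrable measurableT _ _ l').
    by apply/measurable_EFinP; exact: measurable_maxr.
  move=> x _; rewrite lee_fin /u3 [leRHS]ger0_norm ?addr_ge0//.
  by case: (leP (u1 x) (u2 x)) => _; rewrite ?lerDl ?lerDr.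
have l13 : leb.-integrable setT (fun x => (u3 x - u1 x)%:E).
  by apply: eq_integrable (integrableB _ l3 l1).
have l23 : leb.-integrable setT (fun x => (u3 x - u2 x)%:E).
  by apply: eq_integrable (integrableB _ l3 l2).
have le1 x : u1 x <= u3 x by rewrite le_max lexx.
have le2 x : u2 x <= u3 x by rewrite le_max lexx orbT.
have mU i j : L1 leb setT i -> L1 leb setT j -> measurable_fun [set: R]
    (fun x => `|hj_solution f i (x, t) - hj_solution f j (x, t)|%:E).
  move=> /L1_admissible ai /L1_admissible aj; apply/measurable_EFinP.
  exact: (measurableT_comp (@normr_measurable R setT)
    (measurable_funB (measurable_hj_slice ai t0) (measurable_hj_slice aj t0))).
apply: (@le_trans _ _ (\int[leb]_x (`|hj_solution f u3 (x, t) - hj_solution f u1 (x, t)|%:E +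
    `|hj_solution f u3 (x, t) - hj_solution f u2 (x, t)|%:E))%E).
  apply: ge0_le_integral => //.
  - exact: mU.
  - by apply: emeasurable_funD; exact: mU.
  move=> x _; rewrite -EFinD lee_fin.
  move: (hj_solution f u1 _) (hj_solution f u2 _) (hj_solution f u3 _) => p1 p2 p3.
  by rewrite addrC [`|p3 - p1|]distrC addrC -{1}(subrKA p3 p1 (- p2)) ler_normD.
rewrite ge0_integralD//; [|exact: mU|exact: mU].
apply: (le_trans (leeD (hj_contraction_le l1 l3 le1 t0) (hj_contraction_le l2 l3 le2 t0))).
rewrite -integralD//; apply: le_integral => //.
- exact: integrableD.
- exact: (integrable_abse l12).
move=> x _ /=; rewrite -EFinD lee_fin /u3.
by case: (leP (u1 x) (u2 x)) => h; have := ler_norm (u1 x - u2 x);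
  have := ler_norm (u2 x - u1 x); rewrite distrC; lra.
Qed.

End hj_slices.

(** * Convergence in L^1 *)

Section L1_convergence.
Context d {T : measurableType d} {R : realType}.
Variable mu : {measure set T -> \bar R}.
Variables (D : set T) (mD : measurable D).
Implicit Types (u v w : T -> R).

Lemma L1_measurable_dist u v : L1 mu D u -> L1 mu D v ->
  measurable_fun D (fun z => `|u z - v z|%:E).
Proof.
move=> /integrableP[/measurable_EFinP mu1 _] /integrableP[/measurable_EFinP mv _].
apply/measurable_EFinP.
exact: (measurableT_comp (@normr_measurable R setT) (measurable_funB mu1 mv)).
Qed.

Lemma L1distC u v : L1dist mu D u v = L1dist mu D v u.
Proof. by apply: eq_integral => z _; rewrite distrC. Qed.

Lemma L1dist_ge0 u v : (0 <= L1dist mu D u v)%E.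
Proof. by apply: integral_ge0 => z _; rewrite lee_fin. Qed.

Lemma L1dist_triangle u v w : L1 mu D u -> L1 mu D v -> L1 mu D w ->
  (L1dist mu D u w <= L1dist mu D u v + L1dist mu D v w)%E.
Proof.
move=> lu lv lw; rewrite /L1dist -ge0_integralD//.
- apply: ge0_le_integral => //.
  + exact: L1_measurable_dist.
  + by apply: emeasurable_funD; exact: L1_measurable_dist.
  + by move=> z _; rewrite -EFinD lee_fin -(subrKA (v z) (u z) (- w z)) ler_normD.
- exact: L1_measurable_dist.
- exact: L1_measurable_dist.
Qed.

Lemma L1cvg_lt un u (e : R) : L1cvg mu D un u -> 0 < e ->
  exists N : nat, forall n, (N <= n)%N -> (L1dist mu D (un n) u < e%:E)%E.
Proof.
move=> [_ /fine_cvgP[fu]] /cvgrPdist_lt cu e0.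
have [N _ hN] := filterI fu (cu _ e0).
exists N => n Nn; have [/= fin] := hN n Nn.
rewrite sub0r normrN ger0_norm ?fine_ge0 ?L1dist_ge0// => lt.
by rewrite -(fineK fin) lte_fin.
Qed.

Lemma L1cvg_cauchy un u : (forall n, L1 mu D (un n)) -> L1cvg mu D un u ->
  L1cauchy mu D un.
Proof.
move=> lun cu; split => // e e0; have e2 : 0 < e / 2 by rewrite divr_gt0.
have [N hN] := L1cvg_lt cu e2; exists N => m n Nm Nn.
apply: le_lt_trans (L1dist_triangle (lun m) cu.1 (lun n)) _.
rewrite (splitr e) EFinD (L1distC u); apply: lteD; exact: hN.
Qed.

Lemma L1cvg_unique un u v : (forall n, L1 mu D (un n)) ->
  L1cvg mu D un u -> L1cvg mu D un v -> \forall z \ae mu, D z -> u z = v z.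
Proof.
move=> lun cu cv.
have : (L1dist mu D u v = 0)%E.
  apply/eqP; rewrite eq_le L1dist_ge0 andbT; apply/lee_addgt0Pr => e e0.
  have e2 : 0 < e / 2 by rewrite divr_gt0.
  have [N1 h1] := L1cvg_lt cu e2; have [N2 h2] := L1cvg_lt cv e2.
  pose n := maxn N1 N2.
  rewrite add0e (le_trans (L1dist_triangle cu.1 (lun n) cv.1))//.
  rewrite (splitr e) EFinD L1distC; apply: leeD; apply: ltW.
    by apply: h1; exact: leq_maxl.
  by apply: h2; exact: leq_maxr.
have [mu1 mv] : measurable_fun D u /\ measurable_fun D v.
  by split; apply/measurable_EFinP; [case/integrableP : cu.1|case/integrableP : cv.1].
have mB : measurable_fun D (fun z => (u z - v z)%:E).
  by apply/measurable_EFinP; exact: measurable_funB.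
move=> uv0; have /(ae_eq_integral_abs _ mD mB) :
    (\int[mu]_(z in D) `|(fun z => (u z - v z)%:E) z| = 0)%E by [].
apply: filterS => z /= uvz Dz; by apply/eqP; case: (uvz Dz) => uv; rewrite -subr_eq0 uv.
Qed.

End L1_convergence.

(** * Comparison, contraction and convergence on time strips *)

Section hj_strips.
Context {R : realType}.
Variables (f : R -> R) (sf : superlin f).
Implicit Types (u : R -> R) (A : set R) (x t T a b : R).

Lemma itvoo_pos a b : 0 <= a -> (`]a, b[%classic : set R) `<=` `]0, +oo[.
Proof.
by move=> a0 t /=; rewrite !in_itv/= andbT => /andP[at_ _]; exact: le_lt_trans at_.
Qed.

Lemma strip_measurable T : measurable (@strip R T).
Proof. exact: measurableX. Qed.

Lemma measurable_hj_strip u A : admissible u -> measurable A -> A `<=` `]0, +oo[ ->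
  measurable_fun ([set: R] `*` A) (hj_solution f u).
Proof.
move=> au mA A0; apply: measurable_funS (measurable_hj sf au).
- by apply: measurableX.
- by move=> z [_ /A0 z0]; split.
Qed.

Lemma hj_comparison u1 u2 : admissible u1 -> admissible u2 ->
  (\forall x \ae leb, u1 x <= u2 x) ->
  \forall z \ae leb2, halfplane z -> hj_solution f u1 z <= hj_solution f u2 z.
Proof.
move=> a1 a2 u12.
have : \forall z \ae leb2, `]0, +oo[%classic z.2 -> hj_solution f u1 z <= hj_solution f u2 z.
  apply: ae2_slices => //.
    have := measurable_fun_ler (measurable_hj sf a1) (measurable_hj sf a2).
    have mH : measurable (@halfplane R) by exact: measurableX.
    move=> /(_ mH [set true] I); congr (measurable _).
    apply/seteqP; split => z /=; first by move=> [[_ z0] ->].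
    by move=> [z0 z12]; split.
  by move=> t t0; apply: hj_comparison_slice => //; move: t0; rewrite /= in_itv/= andbT.
by apply: filterS => z H [_ z0]; exact: H.
Qed.

Lemma hj_contraction u1 u2 A : L1 leb setT u1 -> L1 leb setT u2 ->
  measurable A -> A `<=` `]0, +oo[ ->
  (L1dist leb2 ([set: R] `*` A) (hj_solution f u1) (hj_solution f u2) <=
   leb A * L1dist leb setT u1 u2)%E.
Proof.
move=> l1 l2 mA A0; have a1 := L1_admissible l1; have a2 := L1_admissible l2.
have mB := measurable_funB (measurable_hj_strip a1 mA A0) (measurable_hj_strip a2 mA A0).
have mN := measurableT_comp (@normr_measurable R setT) mB.
have mE : measurable_fun ([set: R] `*` A)
  (fun z => `|hj_solution f u1 z - hj_solution f u2 z|%:E) by exact/measurable_EFinP.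
have -> : L1dist leb2 ([set: R] `*` A) (hj_solution f u1) (hj_solution f u2) =
    (\int[leb]_(t in A) \int[leb]_x
      `|hj_solution f u1 (x, t) - hj_solution f u2 (x, t)|%:E)%E.
  exact: (strip_tonelli mA mE (fun z => normr_ge0 _)).1.
have mG : measurable_fun A (fun t => \int[leb]_x
    `|hj_solution f u1 (x, t) - hj_solution f u2 (x, t)|%:E)%E.
  have mTA : measurable ([set: R] `*` A) by exact: measurableX.
  pose h := (fun z => `|hj_solution f u1 z - hj_solution f u2 z|%:E) \_ ([set: R] `*` A).
  have mh : measurable_fun setT h by apply/(measurable_restrictT _ mTA).
  have h0 z : (0 <= h z)%E by apply: erestrict_ge0 => y _; rewrite lee_fin.
  have := measurable_fun_fubini_tonelli_G (m1 := @lebesgue_measure R) _ mh h0.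
  move=> /(measurable_funTS (D := A)); apply: eq_measurable_fun => t /[!inE] At.
  apply: eq_integral => x _; rewrite /h patchE ifT// inE; exact: (conj I At).
apply: (@le_trans _ _ (\int[leb]_(t in A) (cst (L1dist leb setT u1 u2) t))%E); last first.
  by rewrite integral_cst// muleC.
apply: ge0_le_integral => //.
- by move=> t _; apply: integral_ge0 => x _; rewrite lee_fin.
- by move=> t At; apply: hj_contraction_slice => //; have /A0/= := At; rewrite in_itv/= andbT.
Qed.

(** Translating the variable of the infimum by [x] removes [x] from it. *)
Lemma hj_value_cst0 x t : hj_value f (fun=> 0) (x, t) = hj_value f (fun=> 0) (0, t).
Proof.
have w0 y : primitive (fun=> 0 : R) y = 0 :> R.
  by rewrite /primitive /Rintegral !integral0 oppr0 if_same.
rewrite /hj_value /=; congr inf; apply/seteqP; split => _ [y _ <-].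
  by exists (y - x) => //; rewrite !w0 sub0r opprB.
by exists (y + x) => //; rewrite !w0 sub0r opprD addrCA subrr addr0.
Qed.

Lemma hj_solution_cst0 z : hj_solution f (fun=> 0) z = 0.
Proof.
have vE : (fun x => hj_value f (fun=> 0) (x, z.2)) = cst (hj_value f (fun=> 0) (0, z.2)).
  by apply/funext => x /=; rewrite hj_value_cst0.
by rewrite /hj_solution /partial_x vE derive1_cst.
Qed.

(** Contraction against the zero datum, whose solution vanishes. *)
Lemma hj_L1 u T : L1 leb setT u -> 0 < T -> L1 leb2 (strip T) (hj_solution f u).
Proof.
move=> lu T0; have l0 : L1 leb setT (fun=> 0 : R) by exact: integrable0.
have sub0 := @itvoo_pos 0 T (lexx 0).
have := hj_contraction lu l0 (measurable_itv _) sub0.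
have mU := measurable_hj_strip (L1_admissible lu) (measurable_itv _) sub0.
move=> le; apply/integrableP; split; first exact/measurable_EFinP.
apply: (@le_lt_trans _ _ (leb (`]0%R, T[%classic : set R) * L1dist leb setT u (fun=> 0%R))%E).
  apply: le_trans le; rewrite le_eqVlt; apply/orP; left; apply/eqP.
  by apply: eq_integral => z _ /=; rewrite hj_solution_cst0 subr0.
rewrite lte_mul_pinfty//.
  by rewrite lebesgue_measure_itv/= lte_fin T0.
have /integrableP[_] := lu; apply: le_lt_trans.
rewrite le_eqVlt; apply/orP; left; apply/eqP.
by apply: eq_integral => x _ /=; rewrite subr0.
Qed.

Lemma hj_L1cvg u un T : L1 leb setT u -> (forall n, L1 leb setT (un n)) ->
  L1cvg leb setT un u -> 0 < T ->
  L1cvg leb2 (strip T) (fun n => hj_solution f (un n)) (hj_solution f u).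
Proof.
move=> lu lun [_ cu] T0; split; first exact: hj_L1.
have sub0 := @itvoo_pos 0 T (lexx 0).
have cT : (leb (`]0%R, T[%classic : set R) * L1dist leb setT (un n) u)%E @[n --> \oo] --> 0%E.
  rewrite -(mule0 (leb (`]0%R, T[%classic : set R))); apply: cvgeZl => //.
  by rewrite lebesgue_measure_itv/= lte_fin T0.
apply: (squeeze_cvge _ (cvg_cst 0%E) cT); apply: nearW => n.
by rewrite L1dist_ge0/=; exact: hj_contraction.
Qed.

Lemma hj_limit u un v T : L1 leb setT u -> (forall n, L1 leb setT (un n)) ->
  L1cvg leb setT un u -> 0 < T ->
  L1cvg leb2 (strip T) (fun n => hj_solution f (un n)) v ->
  \forall z \ae leb2, strip T z -> v z = hj_solution f u z.
Proof.
move=> lu lun cu T0 cv.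
have cU := hj_L1cvg lu lun cu T0.
have lU n : L1 leb2 (strip T) (hj_solution f (un n)) by exact: hj_L1.
exact: (L1cvg_unique (mu := leb2) (strip_measurable T) lU cv cU).
Qed.

End hj_strips.

(** * Properties of limits: contraction, local bound, initial trace *)

Section hj_limits.
Context {R : realType}.
Variables (f : R -> R) (sf : superlin f).
Implicit Types (u : R -> R) (v : R * R -> R) (x t T a b : R).

Lemma measurable_strip_slice v b t : L1 leb2 (strip b) v -> 0 < t < b ->
  measurable_fun [set: R] (fun x => v (x, t)).
Proof.
move=> /integrableP[/measurable_EFinP mv _] tb.
by apply: (@measurable_slice _ _ `]0, b[ v) => //; rewrite /= in_itv/= tb.
Qed.

Lemma hj_limit_halfplane u un v : L1 leb setT u -> (forall n, L1 leb setT (un n)) ->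
  L1cvg leb setT un u ->
  (forall T, 0 < T -> L1cvg leb2 (strip T) (fun n => hj_solution f (un n)) v) ->
  \forall z \ae leb2, halfplane z -> v z = hj_solution f u z.
Proof.
move=> lu lun cu cv.
have H (n : nat) : \forall z \ae leb2, strip n.+1%:R z -> v z = hj_solution f u z.
  by apply: (hj_limit sf lu lun cu _ (cv _ _)).
have := ae_foralln H; apply: filterS => z vz /halfplaneP z0.
apply: (vz (Num.truncn z.2)); split => //=.
by rewrite in_itv/= z0 truncnS_gt.
Qed.

Lemma hj_limits_contraction u1 u2 v1 v2 a T : L1 leb setT u1 -> L1 leb setT u2 ->
  L1 leb2 (strip T) v1 -> L1 leb2 (strip T) v2 ->
  (\forall z \ae leb2, strip T z -> v1 z = hj_solution f u1 z) ->
  (\forall z \ae leb2, strip T z -> v2 z = hj_solution f u2 z) ->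
  0 < a < T ->
  (\int[leb]_x \int[leb]_(t in `]a, T[) `|v1 (x, t) - v2 (x, t)|%:E <=
   (T - a)%:E * \int[leb]_x `|u1 x - u2 x|%:E)%E.
Proof.
move=> l1 l2 lv1 lv2 e1 e2 /andP[a0 aT].
have aTpos := @itvoo_pos _ a T (ltW a0).
have mA : measurable (`]a, T[%classic : set R) by exact: measurable_itv.
have mTA : measurable ([set: R] `*` (`]a, T[%classic : set R)) by exact: measurableX.
have sub : [set: R] `*` (`]a, T[%classic : set R) `<=` strip T.
  move=> z [_ /=]; rewrite /strip/= !in_itv/= => /andP[az ->].
  by split => //; rewrite (lt_trans a0).
have lv1' := integrableS (mu := leb2) (strip_measurable T) mTA sub lv1.
have lv2' := integrableS (mu := leb2) (strip_measurable T) mTA sub lv2.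
have mv := L1_measurable_dist lv1' lv2'.
have -> : (\int[leb]_x \int[leb]_(t in `]a, T[) `|v1 (x, t) - v2 (x, t)|%:E)%E =
    L1dist leb2 ([set: R] `*` (`]a, T[%classic : set R)) v1 v2.
  by symmetry; exact: (strip_tonelli mA mv (fun z => normr_ge0 _)).2.
have T0 : 0 < T by exact: lt_trans aT.
have lU1 := integrableS (mu := leb2) (strip_measurable T) mTA sub (hj_L1 sf l1 T0).
have lU2 := integrableS (mu := leb2) (strip_measurable T) mTA sub (hj_L1 sf l2 T0).
have mU := L1_measurable_dist lU1 lU2.
have -> : L1dist leb2 ([set: R] `*` (`]a, T[%classic : set R)) v1 v2 =
    L1dist leb2 ([set: R] `*` (`]a, T[%classic : set R)) (hj_solution f u1) (hj_solution f u2).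
  apply: (@ae_eq_integral _ _ _ leb2 _ _ _ mTA mv mU).
  by apply: filterS2 e1 e2 => z v1z v2z Az; rewrite v1z ?v2z//; exact: sub.
apply: le_trans (hj_contraction sf l1 l2 mA aTpos) _.
by rewrite lebesgue_measure_itv/= lte_fin aT -EFinD.
Qed.

(** The positive lower bound on times comes from bounding the continuous function [z.2^-1] on
    [K]. *)
Lemma compact_halfplane_strip (K : set (R * R)) : compact K -> K `<=` halfplane ->
  exists2 ab : R * R, 0 < ab.1 & forall z, K z -> ab.1 <= z.2 < ab.2.
Proof.
move=> cK KH.
have bd (g : R * R -> R) : {within K, continuous g} -> exists M, forall z, K z -> g z < M.
  move=> cg; have /compact_bounded[M [_ hM]] := continuous_compact cg cK.
  exists (M + 2) => z Kz; have := hM (M + 1); rewrite ltrDl => /(_ ltr01 (g z)).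
  have /[swap] /[apply] : (g @` K) (g z) by exists z.
  by move=> /(le_trans (ler_norm _)); lra.
have [M1 hM1] : exists M, forall z, K z -> z.2 < M.
  by apply: bd; apply: continuous_subspaceT => z; exact: cvg_snd.
have [M2 hM2] : exists M, forall z, K z -> z.2^-1 < M.
  apply: bd; apply: continuous_in_subspaceT => z /[!inE] Kz.
  apply: cvgV; last exact: cvg_snd.
  by rewrite gt_eqF//; apply/halfplaneP; exact: KH.
exists ((`|M2| + 1)^-1, M1) => /=; first by rewrite invr_gt0; have := normr_ge0 M2; lra.
move=> z Kz; rewrite hM1// andbT.
have /halfplaneP z0 := KH _ Kz.
rewrite -[leRHS]invrK lef_pV2 ?posrE ?invr_gt0//.
by rewrite (le_trans (ltW (hM2 _ Kz)))//; have := ler_norm M2; lra.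
Qed.

(** All times in [K] are at least some [a > 0], and from [a] on the solution is bounded by a
    Lipschitz constant of the values. *)
Lemma hj_limit_Loo u v (K : set (R * R)) : L1 leb setT u ->
  (forall T, 0 < T -> L1 leb2 (strip T) v) ->
  (\forall z \ae leb2, halfplane z -> v z = hj_solution f u z) ->
  compact K -> K `<=` halfplane -> Loo leb2 K v.
Proof.
move=> lu lv vU cK KH.
have [[a b]/= a0 hK] := compact_halfplane_strip cK KH.
have [L L0 hL] := hj_bound sf (L1_admissible lu) a0.
have UL : \forall z \ae leb2, `[a, +oo[%classic z.2 -> `|hj_solution f u z| <= L.
  apply: ae2_slices => //.
    have mA : measurable ([set: R] `*` (`[a, +oo[%classic : set R)) by exact: measurableX.
    have sA : (`[a, +oo[%classic : set R) `<=` `]0, +oo[.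
      by move=> t /=; rewrite !in_itv/= !andbT; exact: lt_le_trans.
    have mU := measurable_hj_strip sf (L1_admissible lu) (measurable_itv _) sA.
    have mN := measurableT_comp (@normr_measurable R setT) mU.
    have := measurable_fun_ler mN (@measurable_cst _ _ _ _ _ L).
    move=> /(_ mA [set true] I); congr (measurable _).
    apply/seteqP; split => z /=; first by move=> [[_ z0] ->].
    by move=> [z0 z12]; split.
  by move=> t; rewrite /= in_itv/= andbT; exact: hL.
have mK : measurable K.
  by apply: closed_measurable2; apply: compact_closed => //; exact: norm_hausdorff.
rewrite /Loo; apply/andP; split; rewrite inE/=.
  apply/(measurable_restrictT _ mK).
  (* An empty [K] does not force [0 < b], which is needed to use the measurability of [v] on
     [strip b]. *)
  have [->|/set0P[z0 Kz0]] := eqVneq K set0; first exact: measurable_fun_set0.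
  have b0 : 0 < b by have /andP[/(lt_le_trans a0) + /ltW] := hK _ Kz0; exact: lt_le_trans.
  have /integrableP[/measurable_EFinP mv _] := lv _ b0.
  apply: measurable_funS mv; first exact: strip_measurable.
  move=> z /[dup] /KH/halfplaneP z20 /hK/andP[_ zb]; split => //=.
  by rewrite in_itv/= z20.
rewrite /finite_norm unlock /Lnorm; case: ifPn => // _.
apply: (@le_lt_trans _ _ L%:E); last exact: ltry.
apply/ess_supP; apply: filterS2 vU UL => z vU UL /=.
rewrite lee_fin patchE; case: ifPn => [/[!inE] Kz|_]; last by rewrite normr0.
rewrite vU; last exact: KH.
by apply: UL => /=; rewrite in_itv/= andbT; have /andP[] := hK _ Kz.
Qed.

(** The integral of the solution over [[a, b]] is an increment of the value, which tends to that of
    the primitive. The limit is essential because [v] is identified with the solution on almost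
    every slice only. *)
Lemma hj_limit_initial u v a b : L1 leb setT u ->
  (forall T, 0 < T -> L1 leb2 (strip T) v) ->
  (\forall z \ae leb2, halfplane z -> v z = hj_solution f u z) -> a <= b ->
  ess_cvg_at_0 (fun t => \int[leb]_(x in `[a, b]) (v (x, t))%:E)%E
    (\int[leb]_(x in `[a, b]) (u x)%:E)%E.
Proof.
move=> lu lv vU ab; have au := L1_admissible lu.
have [iu [C [K gw]]] := au; have cw := primitive_continuous iu.
have -> : (\int[leb]_(x in `[a, b]) (u x)%:E)%E = (primitive u b - primitive u a)%:E.
  by rewrite primitive_diff// fineK//; exact: integrable_fin_num.
move=> S [e/= e0 eS].
have e3 : 0 < e / 3 by lra.
have cg := fenchel_cvx sf; have sg := fenchel_superlin sf.
have [da da0 ha] := hopf_lax_init cg sg gw (cw a) e3.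
have [db db0 hb] := hopf_lax_init cg sg gw (cw b) e3.
exists (Num.min da db); first by rewrite lt_min da0.
have := slices_ae2 vU; apply: filterS => t vUt /andP[t0].
rewrite lt_min => /andP[tda tdb].
have -> : (\int[leb]_(x in `[a, b]) (v (x, t))%:E)%E =
    (hj_value f u (b, t) - hj_value f u (a, t))%:E.
  rewrite -hj_integral//.
  have t1 : 0 < t + 1 by lra.
  have tt1 : 0 < t < t + 1 by rewrite t0 ltrDl ltr01.
  have mv := measurable_strip_slice (lv _ t1) tt1.
  have mU := measurable_hj_slice sf au t0.
  apply: ae_eq_integral => //.
  - by apply/measurable_EFinP; exact: measurable_funTS.
  - by apply/measurable_EFinP; exact: measurable_funTS.
  - apply: filterS vUt => x + _; move=> ->//; exact/halfplaneP.
apply: eS => /=.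
have := ha t; have := hb t; rewrite t0 tda tdb => /(_ isT) Hb /(_ isT) Ha.
rewrite /ball/=.
rewrite -[hopf_lax _ _ a t]/(hj_value f u (a, t)) in Ha.
rewrite -[hopf_lax _ _ b t]/(hj_value f u (b, t)) in Hb.
move: Ha Hb; move: (hj_value f u (a, t)) (hj_value f u (b, t)) => Va Vb.
move: (primitive u a) (primitive u b) => wa wb Ha Hb.
rewrite (_ : wb - wa - (Vb - Va) = (Va - wa) - (Vb - wb)); last by ring.
by apply: le_lt_trans (ler_normB _ _) _; lra.
Qed.

End hj_limits.

(** * Lipschitz functions on a compact interval *)

Section lipschitz_on_itv.
Context {R : realType}.
Implicit Types (F k : R -> R) (a b K : R).

(** Projection onto [[a, b]]: composing with it extends a Lipschitz function from the interval to
    the line and keeps its derivatives at interior points. *)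
Definition clamp a b x : R := Num.max a (Num.min b x).

Lemma clamp_itv a b x : a <= b -> a <= clamp a b x <= b.
Proof.
by move=> ab; rewrite /clamp le_max lexx/= ge_max ab ge_min lexx.
Qed.

Lemma clamp_id a b x : a <= x <= b -> clamp a b x = x.
Proof. by move=> /andP[ax xb]; rewrite /clamp min_r// max_r. Qed.

Lemma clamp_lip a b x y : `|clamp a b x - clamp a b y| <= `|x - y|.
Proof.
have max_lip (c z w : R) : `|Num.max c z - Num.max c w| <= `|z - w|.
  by case: (leP c z); case: (leP c w) => h1 h2; rewrite ?subrr ?normr0//;
    rewrite !ler_norml; apply/andP; split; case: (ger0P (z - w)); lra.
have min_lip (c z w : R) : `|Num.min c z - Num.min c w| <= `|z - w|.
  by case: (leP c z); case: (leP c w) => h1 h2; rewrite ?subrr ?normr0//;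
    rewrite !ler_norml; apply/andP; split; case: (ger0P (z - w)); lra.
exact: le_trans (max_lip _ _ _) (min_lip _ _ _).
Qed.

Lemma lip_itv_integral K F k a b :
  (forall x y, a <= x <= b -> a <= y <= b -> `|F x - F y| <= K * `|x - y|) ->
  a <= b -> measurable_fun `[a, b] k ->
  {ae leb, forall x, a < x < b -> derivable F x 1 -> k x = derive1 F x} ->
  (\int[leb]_(x in `[a, b]) (k x)%:E = (F b - F a)%:E)%E.
Proof.
move=> lF ab mk kF; pose G x := F (clamp a b x).
have lG : lip `|K| G.
  move=> x y; apply: le_trans (lF _ _ (clamp_itv _ ab) (clamp_itv _ ab)) _.
  apply: le_trans (ler_wpM2r (normr_ge0 _) (ler_norm K)) _.
  exact: ler_wpM2l (clamp_lip _ _ _ _).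
have GE x : a <= x <= b -> G x = F x by move=> xab; rewrite /G clamp_id.
rewrite (lip_integral lG ab mk); first by rewrite !GE ?lexx ?ab.
apply: filterS kF => x kx xab dG; have /andP[ax xb] := xab.
suff /deriv_atP[dF lE] : deriv_at F x (derive1 G x) by rewrite kx.
apply: (@deriv_at_near _ F G _ _ 0 (Num.min (x - a) (b - x))).
- by rewrite lt_min !subr_gt0 ax.
- move=> h; rewrite lt_min !ltr_norml => /andP[/andP[h1 h2] /andP[h3 h4]].
  by rewrite addr0 GE//; apply/andP; split; lra.
- exact: deriv_at_derive1.
Qed.

End lipschitz_on_itv.

Section lipschitz_from_derivative.
Context {R : realType}.

Lemma derivable_lip (F : R -> R) M :
  (forall x, derivable F x 1) -> (forall x, `|derive1 F x| <= M) -> lip M F.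
Proof.
move=> dF dM x y; wlog xy : x y / x < y.
  move=> H; have [->|] := eqVneq x y; first by rewrite !subrr normr0 mulr0.
  rewrite neq_lt => /orP[xy|yx]; first exact: H.
  by rewrite distrC (distrC x); exact: H.
have [z _ zE] : exists2 z, z \in `]x, y[ & F y - F x = derive1 F z * (y - x).
  apply: (@MVT _ F (derive1 F)) => //.
    by move=> z _; apply: DeriveDef => //; rewrite derive1E.
  by apply: derivable_within_continuous => z _.
by rewrite distrC zE normrM (distrC x) ler_wpM2r.
Qed.

End lipschitz_from_derivative.

(** * Support and bounds of test functions *)

Section test_functions.
Context {R : realType}.
Variable phi : R * R -> R.
Hypothesis tphi : test_function halfplane phi.

Let phi_x := partial_x phi.
Let phi_t := partial_t phi.
Let S := closure [set z | phi z != 0].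

Lemma test_continuous : continuous phi.
Proof. by have [/(_ 0%N)[]] := tphi. Qed.

Lemma test_partials : [/\ forall z, derivable (fun x => phi (x, z.2)) z.1 1,
  forall z, derivable (fun t => phi (z.1, t)) z.2 1,
  continuous phi_x & continuous phi_t].
Proof. by have [/(_ 1%N)[_ [? ? [? _] [? _]]]] := tphi. Qed.

Lemma test_derivs : (forall x t, deriv_at (fun x => phi (x, t)) x (phi_x (x, t))) /\
  (forall x t, deriv_at (fun t => phi (x, t)) t (phi_t (x, t))).
Proof.
have [dx dt _ _] := test_partials; split => x t.
  exact: deriv_at_derive1 (dx (x, t)).
exact: deriv_at_derive1 (dt (x, t)).
Qed.

Lemma test_support : exists A a b, [/\ 0 < A, 0 < a, a < b &
  forall x t, ~ (`|x| < A /\ a < t < b) ->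
    [/\ phi (x, t) = 0, phi_x (x, t) = 0 & phi_t (x, t) = 0]].
Proof.
have [_ cS SH] := tphi; rewrite -/S in cS SH.
have [[a b]/= a0 hab] := compact_halfplane_strip cS SH.
have [M hM] : exists M, forall z, S z -> `|z.1| <= M.
  have cf1 : {within S, continuous (fst : R * R -> R)}.
    by apply: continuous_subspaceT => z; exact: cvg_fst.
  have /compact_bounded[M [_ hM]] := continuous_compact cf1 cS.
  exists (M + 1) => z Sz; apply: (hM (M + 1)); first by rewrite ltrDl.
  by exists z.
(* The box is enlarged so that the support lies in its interior and [phi] vanishes on its sides. The
   maximum in [b'] keeps the times ordered even when the support is empty. *)
pose A := `|M| + 1; pose b' := Num.max b a + 1.
have A0 : 0 < A by rewrite /A; have := normr_ge0 M; lra.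
have ba : a < b' by rewrite /b' (@le_lt_trans _ _ (Num.max b a)) ?le_max ?lexx ?orbT// ltrDl.
exists A, (a / 2), b'; split => //; first by rewrite divr_gt0.
  by apply: lt_trans ba; lra.
move=> x t nxt.
have nS : ~ S (x, t).
  move=> Sxt; apply: nxt; split.
    by have := hM _ Sxt; rewrite /A /=; have := ler_norm M; lra.
  have /= /andP[at_ tb] := hab _ Sxt; apply/andP; split; first by lra.
  by rewrite /b' (lt_le_trans tb)// (@le_trans _ _ (Num.max b a)) ?le_max ?lexx// lerDl.
have phi0 : phi (x, t) = 0.
  by apply/eqP; apply/negPn/negP => p0; apply: nS; exact: subset_closure.
have /nbhs_ballP[e/= e0 he] : nbhs (x, t) (~` S).
  by apply: open_nbhs_nbhs; split => //; apply: closed_openC; exact: closed_closure.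
have ball0 (y s : R) : `|y - x| < e -> `|s - t| < e -> phi (y, s) = 0.
  move=> yx st; apply/eqP; apply/negPn/negP => p0.
  apply: (he (y, s)); last exact: subset_closure.
  by split => /=; rewrite /ball/= distrC.
have z0 (y : R) : deriv_at (fun=> 0 : R) y 0.
  by apply/deriv_atP; split; [exact: derivable_cst|rewrite derive1_cst].
split => //.
  have /deriv_atP[_ <-]// : deriv_at (fun y => phi (y, t)) x 0.
  apply: (@deriv_at_near _ _ (fun=> 0) _ _ 0 e) => //.
  by move=> h he'; rewrite addr0 ball0 ?subrr ?normr0// addrC addKr.
have /deriv_atP[_ <-]// : deriv_at (fun s => phi (x, s)) t 0.
apply: (@deriv_at_near _ _ (fun=> 0) _ _ 0 e) => //.
by move=> h he'; rewrite addr0 ball0 ?subrr ?normr0// addrC addKr.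
Qed.

Lemma test_bounded : exists2 M, 0 <= M & forall z,
  [/\ `|phi z| <= M, `|phi_x z| <= M & `|phi_t z| <= M].
Proof.
have [A [a [b [A0 a0 ab zero]]]] := test_support.
have [_ _ cx ct] := test_partials.
pose K : set (R * R) := (`[- A, A]%classic : set R) `*` (`[a, b]%classic : set R).
have cK : compact K by apply: compact_setX; exact: segment_compact.
have bd (g : R * R -> R) : continuous g -> exists M, forall z, K z -> `|g z| <= M.
  move=> cg; have cg' : {within K, continuous g} by exact: continuous_subspaceT.
  have /compact_bounded[M [_ hM]] := continuous_compact cg' cK.
  exists (M + 1) => z Kz; apply: (hM (M + 1)); first by rewrite ltrDl.
  by exists z.
have [M1 h1] := bd _ test_continuous; have [M2 h2] := bd _ cx; have [M3 h3] := bd _ ct.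
pose M := `|M1| + `|M2| + `|M3|.
have [m1 m2 m3] : [/\ M1 <= M, M2 <= M & M3 <= M].
  have := ler_norm M1; have := ler_norm M2; have := ler_norm M3.
  have := normr_ge0 M1; have := normr_ge0 M2; have := normr_ge0 M3.
  by rewrite /M => *; split; lra.
exists M; first by rewrite /M !addr_ge0.
move=> [x t]; have [Kz|nK] := pselect (K (x, t)).
  by split; [apply: le_trans m1; exact: h1|apply: le_trans m2; exact: h2|apply: le_trans m3; exact: h3].
have [| -> -> ->] := zero x t; last by rewrite normr0 /M !addr_ge0.
move=> [xA /andP[at_ tb]]; apply: nK; split => /=; rewrite in_itv/=.
  by move: xA; rewrite ltr_norml => /andP[/ltW -> /ltW ->].
by rewrite !ltW.
Qed.

Lemma test_lip : exists2 M, 0 <= M &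
  (forall t, lip M (fun x => phi (x, t))) /\ (forall x, lip M (fun t => phi (x, t))).
Proof.
have [M M0 hM] := test_bounded; have [dx dt _ _] := test_partials.
exists M => //; split => [t|x]; apply: derivable_lip => y.
- exact: (dx (y, t)).
- by have [] := hM (y, t).
- exact: (dt (x, y)).
- by have [] := hM (x, y).
Qed.

End test_functions.

(** * The weak formulation for an abstract value function *)

Lemma right_derivative_seq {R : realType} (D : R -> R) l :
  (forall e, 0 < e -> exists2 d, 0 < d &
    forall h, 0 < h < d -> `|D h - l * h| <= e * h) ->
  D n.+1%:R^-1 / n.+1%:R^-1 @[n --> \oo] --> l.
Proof.
move=> Dl; apply/cvgrPdist_le => e e0; have [d d0 hd] := Dl e e0.
near=> n; have h0 : 0 < n.+1%:R^-1 :> R by rewrite invr_gt0.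
have hn : n.+1%:R^-1 < d by near: n; exact: near_infty_natSinv_lt (PosNum d0).
have := hd n.+1%:R^-1; rewrite h0 hn => /(_ isT) H.
move: H h0; move: (n.+1%:R^-1) => h H h0; rewrite -(ler_pM2r h0); apply: le_trans H.
have -> : D h - l * h = - ((l - D h / h) * h) by field; rewrite gt_eqF.
by rewrite normrN normrM (gtr0_norm h0).
Unshelve. all: by end_near. Qed.

(* V is the value function and U its x-derivative; p is the test function and
   px, pt are its partial derivatives. *)
Section weak_formulation.
Context {R : realType}.
Variables (f : R -> R) (V U p px pt : R -> R -> R) (A s0 s1 L B M : R).
Hypotheses (A0 : 0 < A) (s01 : s0 <= s1) (L0 : 0 <= L) (B0 : 0 <= B) (M0 : 0 <= M).
Hypothesis fc : continuous f.
Hypothesis V_lip : forall t, s0 <= t -> lip L (V ^~ t).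
Hypothesis V_time_lip : forall x t h, s0 <= t -> 0 < h ->
  `|V x (t + h) - V x t| <= B * h.
Hypothesis V_time_derivative : forall x t q, s0 <= t -> deriv_at (V ^~ t) x q ->
  forall e, 0 < e -> exists2 d, 0 < d &
    forall h, 0 < h < d -> `|V x (t + h) - V x t + h * f q| <= e * h.
Hypothesis mU : forall t, s0 <= t -> measurable_fun [set: R] (U ^~ t).
Hypothesis U_bound : forall t, s0 <= t -> \forall x \ae leb, `|U x t| <= L.
Hypothesis U_deriv : forall t, s0 <= t ->
  \forall x \ae leb, deriv_at (V ^~ t) x (U x t).
Hypothesis p_lip : forall t, lip M (p ^~ t).
Hypothesis p_time_lip : forall x, lip M (p x).
Hypothesis p_bound : forall x t, `|p x t| <= M.
Hypothesis px_bound : forall x t, `|px x t| <= M.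
Hypothesis p_deriv_x : forall x t, deriv_at (p ^~ t) x (px x t).
Hypothesis p_deriv_t : forall x t, deriv_at (p x) t (pt x t).
Hypothesis mpx : forall t, measurable_fun [set: R] (px ^~ t).
Hypothesis mpt : forall t, measurable_fun [set: R] (pt ^~ t).
Hypothesis cpx : forall x, continuous (px x).
Hypothesis p_side : forall t, p A t = 0 /\ p (- A) t = 0.
Hypothesis p_end : forall x, p x s0 = 0 /\ p x s1 = 0.

Let AA : - A <= A.
Proof. by rewrite (@le_trans _ _ 0)// ?oppr_le0 ltW. Qed.

Let mV t : s0 <= t -> measurable_fun [set: R] (V ^~ t).
Proof.
move=> t0; apply: continuous_measurable_fun; exact: lip_continuous (V_lip t0).
Qed.

Let mp t : measurable_fun [set: R] (p ^~ t).
Proof. by apply: continuous_measurable_fun; exact: lip_continuous (p_lip t). Qed.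

Let V_bound t : s0 <= t -> exists2 K, 0 <= K & forall x, - A <= x <= A -> `|V x t| <= K.
Proof.
move=> t0; exists (`|V 0 t| + L * A); first by rewrite addr_ge0// mulr_ge0// ltW.
move=> x; rewrite -ler_norml => xA; rewrite -[V x t](subrKC (V 0 t)).
rewrite (le_trans (ler_normD _ _))// lerD2l (le_trans (V_lip t0 _ _))//.
by rewrite subr0 ler_wpM2l.
Qed.

Let iUp s t : s0 <= s -> leb.-integrable `[- A, A] (EFin \o (fun x => U x s * p x t)).
Proof.
move=> s0s; apply: (@ae_bounded_integrable _ _ (L * M)).
- by apply: measurable_funTS; apply: measurable_funM; [exact: mU|exact: mp].
- exact: mulr_ge0.
- apply: filterS (U_bound s0s) => x Ux _.
  by rewrite normrM ler_pM.
Qed.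

Let iVpx s t : s0 <= s -> leb.-integrable `[- A, A] (EFin \o (fun x => V x s * px x t)).
Proof.
move=> s0s; have [K K0 VK] := V_bound s0s.
apply: (@ae_bounded_integrable _ _ (K * M)).
- by apply: measurable_funTS; apply: measurable_funM; [exact: mV|exact: mpx].
- exact: mulr_ge0.
- by apply: aeW => x xA; rewrite normrM ler_pM// VK.
Qed.

(** The product of [V] and [p] is Lipschitz on [[- A, A]] and vanishes at both ends. The identity
    moves time increments from [U], where they are not controlled, to [V], where they are. *)
Let by_parts s t : s0 <= s ->
  \int[leb]_(x in `[- A, A]) (U x s * p x t) =
  - \int[leb]_(x in `[- A, A]) (V x s * px x t).
Proof.
move=> s0s; apply/eqP; rewrite -addr_eq0 -RintegralD//; [|exact: iUp|exact: iVpx].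
apply/eqP; rewrite /Rintegral.
have [K K0 VK] := V_bound s0s.
rewrite (@lip_itv_integral _ (L * M + K * M) (fun x => V x s * p x t)).
- by have [-> ->] := p_side t; rewrite !mulr0 subrr.
- move=> x y xA yA.
  rewrite (_ : V x s * p x t - V y s * p y t =
    (V x s - V y s) * p x t + V y s * (p x t - p y t)); last by ring.
  rewrite (le_trans (ler_normD _ _))// !normrM mulrDl lerD//.
    by rewrite mulrAC ler_pM//; exact: V_lip.
  by rewrite -mulrA ler_pM//; [exact: VK|exact: p_lip].
- exact: AA.
- apply: measurable_funTS; apply: measurable_funD; apply: measurable_funM => //.
  + exact: mU.
  + exact: mV.
- apply: filterS (U_deriv s0s) => x Vx _ _.
  by have /deriv_atP[_ ->] := deriv_atM Vx (p_deriv_x x t).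
Qed.

Let m t := \int[leb]_(x in `[- A, A]) (U x t * p x t).

(** Integrand of the difference quotient of [m] after a discrete product rule: the increment of [p]
    is taken against [U] at time [t], and that of [U], integrated by parts, against [p] at time
    [t + h]. *)
Let quot h t x := U x t * ((p x (t + h) - p x t) / h) -
  (V x (t + h) - V x t) / h * px x (t + h).

Let k t := \int[leb]_(x in `[- A, A]) (U x t * pt x t + f (U x t) * px x t).

Let mquot h t : s0 <= t -> 0 < h -> measurable_fun [set: R] (quot h t).
Proof.
move=> t0 h0; have th : s0 <= t + h by lra.
apply: measurable_funB; apply: measurable_funM => //.
- exact: mU.
- apply: measurable_funM; last exact: measurable_cst.
  by apply: measurable_funB; exact: mp.
- apply: measurable_funM; last exact: measurable_cst.
  by apply: measurable_funB; exact: mV.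
Qed.

Let quot_bound h t : s0 <= t -> 0 < h ->
  \forall x \ae leb, `|quot h t x| <= L * M + B * M.
Proof.
move=> t0 h0; apply: filterS (U_bound t0) => x Ux.
rewrite /quot (le_trans (ler_normB _ _))// !normrM normfV (gtr0_norm h0) lerD//.
  rewrite ler_pM ?divr_ge0 ?(ltW h0)// ler_pdivrMr//.
  have := p_time_lip x (t + h) t; have -> : t + h - t = h by ring.
  by rewrite (gtr0_norm h0).
rewrite ler_pM ?divr_ge0 ?(ltW h0)// ler_pdivrMr//; exact: V_time_lip.
Qed.

Let m_quot h t : s0 <= t -> 0 < h ->
  m (t + h) - m t = h * \int[leb]_(x in `[- A, A]) quot h t x.
Proof.
move=> t0 h0; have th : s0 <= t + h by lra.
have C0 : 0 <= L * M + B * M by rewrite addr_ge0// mulr_ge0.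
have iq : leb.-integrable `[- A, A] (EFin \o quot h t).
  apply: (ae_bounded_integrable _ C0); first exact: measurable_funTS (mquot t0 h0).
  by apply: filterS (quot_bound t0 h0).
rewrite -RintegralZl//.
pose N s r := \int[leb]_(x in `[- A, A]) (U x s * p x r).
have -> : m (t + h) - m t = (N (t + h) (t + h) - N t (t + h)) + (N t (t + h) - N t t).
  by rewrite /N /m; ring.
rewrite {1 2}/N !by_parts// opprK addrC addrA.
rewrite {1 2}/N -RintegralB//; [|exact: iUp|exact: iUp].
have iB : leb.-integrable `[- A, A] (EFin \o (fun x => U x t * p x (t + h) - U x t * p x t)).
  by apply: eq_integrable (integrableB _ (iUp _ t0) (iUp _ t0)).
rewrite -RintegralB//; last exact: iVpx.
have iC : leb.-integrable `[- A, A] (EFin \o (fun x =>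
    U x t * p x (t + h) - U x t * p x t - V x (t + h) * px x (t + h))).
  by apply: eq_integrable (integrableB _ iB (iVpx _ th)).
rewrite -RintegralD//; last exact: iVpx.
by apply: eq_Rintegral => x _; rewrite /quot; field; rewrite gt_eqF.
Qed.

Let m_lip x y : s0 <= x -> s0 <= y ->
  `|m x - m y| <= (L * M + B * M) * (A - - A) * `|x - y|.
Proof.
have C0 : 0 <= L * M + B * M by rewrite addr_ge0// mulr_ge0.
wlog yx : x y / y < x.
  move=> H xs ys; have [->|] := eqVneq x y; first by rewrite !subrr normr0 mulr0.
  rewrite neq_lt => /orP[xy|yx]; last exact: H.
  by rewrite distrC (distrC x); exact: H.
move=> _ y0; have h0 : 0 < x - y by rewrite subr_gt0.
have := m_quot y0 h0; rewrite subrKC => ->.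
rewrite normrM mulrC ler_wpM2r//.
apply: ae_bounded_Rintegral => //; first exact: measurable_funTS (mquot y0 h0).
by apply: filterS (quot_bound y0 h0).
Qed.

(** Dominated convergence under the constant of [quot_bound]. The integrand converges wherever [V]
    has an x-derivative, so the limit holds for every [t >= s0] and not merely almost every one. *)
Let m_deriv_seq t : s0 <= t ->
  (m (t + n.+1%:R^-1) - m t) / n.+1%:R^-1 @[n --> \oo] --> k t.
Proof.
move=> t0; pose h (n : nat) : R := n.+1%:R^-1.
have h0 n : 0 < h n by rewrite invr_gt0.
have C0 : 0 <= L * M + B * M by rewrite addr_ge0// mulr_ge0.
rewrite (_ : (fun n => _) = fun n => \int[leb]_(x in `[- A, A]) quot (h n) t x); last first.
  by apply/funext => n; rewrite m_quot// mulrAC divff ?mul1r// gt_eqF.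
pose lim x := U x t * pt x t + f (U x t) * px x t.
have mlim : measurable_fun [set: R] lim.
  apply: measurable_funD; apply: measurable_funM => //; first exact: mU.
  by apply: measurableT_comp; [exact: continuous_measurable_fun|exact: mU].
have [] := @dominated_convergence _ _ _ leb (`[- A, A]%classic : set (measurableTypeR R))
  (measurable_itv _) (fun n => EFin \o quot (h n) t) (EFin \o lim) (cst (L * M + B * M)%:E).
- by move=> n; apply/measurable_EFinP; exact: measurable_funTS (mquot t0 (h0 n)).
- by apply/measurable_EFinP; exact: measurable_funTS.
- apply: filterS (U_deriv t0) => x Vx _.
  suff : quot (h n) t x @[n --> \oo] --> lim x by move=> cq; apply: cvg_EFin; [exact: nearW|exact: cq].
  have ht : t + h n @[n --> \oo] --> t.
    rewrite -{2}(addr0 t); apply: (cvgD (cvg_cst t)).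
    exact: cvg_harmonic.
  have -> : lim x = U x t * pt x t - (- f (U x t)) * px x t by rewrite /lim; ring.
  apply: cvgB; apply: cvgM; first exact: cvg_cst.
  + apply: (@right_derivative_seq _ (fun h => p x (t + h) - p x t)) => e e0.
    have [d d0 hd] := p_deriv_t x t e0; exists d => // r /andP[r0 rd].
    by have := hd r; rewrite (gtr0_norm r0); exact.
  + apply: (@right_derivative_seq _ (fun h => V x (t + h) - V x t)) => e e0.
    have [d d0 hd] := V_time_derivative t0 Vx e0; exists d => // r rd.
    by rewrite mulNr opprK (mulrC (f _)); exact: hd.
  + exact: (cvg_comp _ _ ht (@cpx x t)).
- apply: (@ae_bounded_integrable _ (cst (L * M + B * M)) _ _ _ _ C0) => //.
  by apply: aeW => x _; rewrite /= ger0_norm.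
- have := ae_foralln (fun n => quot_bound t0 (h0 n)).
  by apply: filterS => x qx n _; rewrite /= lee_fin.
move=> il _; have fl : (\int[leb]_(x in `[(- A)%R, A]) (EFin \o lim) x)%E \is a fin_num.
  exact: integrable_fin_num.
by rewrite -(fineK fl) => /fine_cvg.
Qed.

Let m_cst t : (forall x, p x t = 0) -> m t = 0.
Proof.
move=> pt0; have -> : m t = \int[leb]_(x in `[- A, A]) 0.
  by apply: eq_Rintegral => x _; rewrite pt0 mulr0.
by rewrite /Rintegral integral0.
Qed.

(** On [[s0, s1]], [k] is the pointwise limit of difference quotients of the Lipschitz function
    [m]. *)
Lemma weak_density_measurable : measurable_fun `[s0, s1] k.
Proof.
have mm (a : R) : 0 <= a -> measurable_fun `[s0, s1] (fun t => m (t + a)).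
  move=> a0; pose C := (L * M + B * M) * (A - - A).
  have C0 : 0 <= C.
    apply: mulr_ge0; last by rewrite subr_ge0.
    by rewrite addr_ge0// mulr_ge0.
  (* [m] is controlled only from [s0] on, so [t] is clamped to get continuity on the whole line; the
     shift by [a] may pass [s1] but never falls below [s0]. *)
  have cl : continuous (fun t => m (clamp s0 s1 t + a)).
    apply: (@lip_continuous _ C) => x y.
    have /andP[x0 _] := clamp_itv x s01; have /andP[y0 _] := clamp_itv y s01.
    apply: (le_trans (m_lip _ _)); [by rewrite ler_wpDr|by rewrite ler_wpDr|].
    have -> : clamp s0 s1 x + a - (clamp s0 s1 y + a) = clamp s0 s1 x - clamp s0 s1 y by ring.
    by rewrite ler_wpM2l// clamp_lip.
  apply: (@eq_measurable_fun _ _ _ _ _ (fun t => m (clamp s0 s1 t + a))).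
    by move=> t /[!inE]/=; rewrite in_itv/= => /clamp_id ->.
  by apply: measurable_funTS; exact: continuous_measurable_fun.
apply: (@measurable_fun_cvg _ _ R `[s0, s1]%classic
  (fun n (t : R) => (m (t + n.+1%:R^-1) - m t) / n.+1%:R^-1) k).
  move=> n; apply: measurable_funM; last exact: measurable_cst.
  apply: measurable_funB; first by apply: mm; rewrite invr_ge0.
  apply: eq_measurable_fun (mm 0 (lexx 0)).
  by move=> t _ /=; rewrite addr0.
by move=> t /=; rewrite in_itv/= => /andP[t0 _]; exact: m_deriv_seq.
Qed.

(** Where [m] is derivable, its derivative is the limit along the steps [n.+1%:R^-1], that is [k].
    The integral is then the increment of [m] between two times at which [p] vanishes. *)
Lemma weak_density_integral : (\int[leb]_(t in `[s0, s1]) (k t)%:E = 0)%E.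
Proof.
have m_lip' x y : s0 <= x <= s1 -> s0 <= y <= s1 ->
    `|m x - m y| <= (L * M + B * M) * (A - - A) * `|x - y|.
  by move=> /andP[x0 _] /andP[y0 _]; exact: m_lip.
rewrite (lip_itv_integral m_lip' s01 weak_density_measurable).
  by rewrite !m_cst ?subrr// => x; case: (p_end x).
apply: aeW => t /andP[/ltW t0 _] /deriv_at_derive1 dm.
apply: (cvg_unique (@Rhausdorff R) (m_deriv_seq t0)).
apply: (@right_derivative_seq _ (fun h => m (t + h) - m t)) => e e0.
have [d d0 hd] := dm e e0; exists d => // r /andP[r0 rd].
by have := hd r; rewrite (gtr0_norm r0); exact.
Qed.

End weak_formulation.

(** * The weak equation for limits of HJ-solutions *)

Section hj_weak.
Context {R : realType}.
Variables (f : R -> R) (cf : cvx f) (sf : superlin f).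
Implicit Types (u : R -> R) (v phi : R * R -> R).

Lemma measurable_halfplane_strips v :
  (forall T, 0 < T -> L1 leb2 (strip T) v) -> measurable_fun halfplane v.
Proof.
move=> lv.
have -> : @halfplane R = \bigcup_(n : nat) strip n.+1%:R.
  apply/seteqP; split => z.
    move=> /halfplaneP z0; exists (Num.truncn z.2) => //; split => //=.
    by rewrite in_itv/= z0 truncnS_gt.
  by move=> [n _ [_]]; rewrite /= in_itv/= => /andP[z0 _]; apply/halfplaneP.
apply/measurable_fun_bigcup => n; first exact: strip_measurable.
have n0 : 0 < n.+1%:R :> R by rewrite ltr0n.
by have /integrableP[/measurable_EFinP] := lv _ n0.
Qed.

(** Tonelli applies to the positive and the negative part of the extension of [g] by 0 separately,
    so integrability is not involved. *)
Lemma measurable_slice_integral (g : R * R -> R) : measurable_fun halfplane g ->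
  measurable_fun (`]0, +oo[%classic : set R) (fun t => \int[leb]_x (g (x, t))%:E)%E.
Proof.
move=> mg; have mH : measurable (@halfplane R) by exact: measurableX.
pose h := (EFin \o g) \_ halfplane.
have mh : measurable_fun setT h.
  by apply/(measurable_restrictT _ mH); exact/measurable_EFinP.
have mp := measurable_funepos mh; have mn := measurable_funeneg mh.
have Gp := measurable_fun_fubini_tonelli_G (m1 := @lebesgue_measure R) _ mp
  (fun z => funepos_ge0 h z).
have Gn := measurable_fun_fubini_tonelli_G (m1 := @lebesgue_measure R) _ mn
  (fun z => funeneg_ge0 h z).
have := emeasurable_funB Gp Gn.
move=> /(measurable_funTS (D := `]0, +oo[%classic : set R)); apply: eq_measurable_fun => t.
rewrite inE/= in_itv/= andbT => t0.
have -> : (\int[leb]_x (g (x, t))%:E = \int[leb]_x h (x, t))%E.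
  by apply: eq_integral => x _; rewrite /h patchE ifT// inE; apply/halfplaneP.
rewrite [RHS]integralE; congr (_ - _)%E; apply: eq_integral => x _.
  by rewrite !funeposE.
by rewrite !funenegE.
Qed.

Lemma hj_limit_weak u v phi : L1 leb setT u ->
  (forall T, 0 < T -> L1 leb2 (strip T) v) ->
  (\forall z \ae leb2, halfplane z -> v z = hj_solution f u z) ->
  test_function halfplane phi ->
  (\int[leb]_(t in `]0%R, +oo[) \int[leb]_x
     (v (x, t) * partial_t phi (x, t) + f (v (x, t)) * partial_x phi (x, t))%:E = 0)%E.
Proof.
move=> lu lv vU tphi; have au := L1_admissible lu.
have [A [a [b [A0 a0 ab zero]]]] := test_support tphi.
have [M1 M10 hM1] := test_bounded tphi.
have [M2 M20 [hM2x hM2t]] := test_lip tphi.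
have [dx dt] := test_derivs tphi.
have [_ _ cx ct] := test_partials tphi.
have cphi := test_continuous tphi.
have [L1' L10 hL1] := hj_lip sf au a0.
have [L2 L20 hL2] := hj_bound sf au a0.
have cg := fenchel_cvx sf; have sg := fenchel_superlin sf.
have [iu [C [K gw]]] := au.
have [B B0 hB] := hopf_lax_time_lip cg sg gw a0.
pose p x t := phi (x, t); pose px x t := partial_x phi (x, t).
pose pt x t := partial_t phi (x, t).
pose V x t := hj_value f u (x, t); pose U x t := hj_solution f u (x, t).
(* The weak formulation takes one constant for bounds and Lipschitz constants alike: [M] for the
   test function, [L] for value and solution. *)
pose M := M1 + M2; pose L := L1' + L2.
have M0 : 0 <= M by exact: addr_ge0.
have L0 : 0 <= L by exact: addr_ge0.
have fc := cvx_continuous cf.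
pose k t := \int[leb]_(x in `[- A, A]) (U x t * pt x t + f (U x t) * px x t).
have slice_cont (g : R * R -> R) : continuous g ->
    (forall t, continuous (fun x => g (x, t))) /\ (forall x, continuous (fun t => g (x, t))).
  move=> cg'; split => [t x|x t].
    apply: (@cvg_comp _ _ _ (fun x => (x, t)) g _ _ _ _ (cg' (x, t))).
    apply: (@cvg_pair _ _ _ (nbhs x) (nbhs x) (nbhs t)); [exact: cvg_id|exact: cvg_cst].
  apply: (@cvg_comp _ _ _ (fun t => (x, t)) g _ _ _ _ (cg' (x, t))).
  apply: (@cvg_pair _ _ _ (nbhs t) (nbhs x) (nbhs t)); [exact: cvg_cst|exact: cvg_id].
have V_lip t : a <= t -> lip L (V ^~ t).
  move=> at_ x y; apply: (le_trans (hL1 t at_ x y)).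
  by rewrite ler_wpM2r// lerDl.
have Ub t : a <= t -> \forall x \ae leb, `|U x t| <= L.
  move=> at_; have := hL2 t at_; apply: filterS => x Ux.
  by rewrite (le_trans Ux)// lerDr.
have mU t : a <= t -> measurable_fun [set: R] (U ^~ t).
  by move=> at_; apply: (measurable_hj_slice sf au); exact: lt_le_trans at_.
have Ud t : a <= t -> \forall x \ae leb, deriv_at (V ^~ t) x (U x t).
  by move=> at_; apply: (hj_ae_deriv sf au); exact: lt_le_trans at_.
have VR x t q : a <= t -> deriv_at (V ^~ t) x q -> forall e, 0 < e -> exists2 d, 0 < d &
    forall h, 0 < h < d -> `|V x (t + h) - V x t + h * f q| <= e * h.
  move=> at_; have t0 : 0 < t by exact: lt_le_trans at_.
  exact: (hopf_lax_time_derivative cf sf gw t0).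
have p_lip t : lip M (p ^~ t).
  by move=> x y; apply: (le_trans (hM2x t x y)); rewrite ler_wpM2r// lerDr.
have p_time_lip x : lip M (p x).
  by move=> s t; apply: (le_trans (hM2t x s t)); rewrite ler_wpM2r// lerDr.
have p_bound x t : `|p x t| <= M.
  by have [pM _ _] := hM1 (x, t); rewrite (le_trans pM)// lerDl.
have px_bound x t : `|px x t| <= M.
  by have [_ pM _] := hM1 (x, t); rewrite (le_trans pM)// lerDl.
have mpx t : measurable_fun [set: R] (px ^~ t).
  by apply: continuous_measurable_fun; exact: (slice_cont _ cx).1.
have mpt t : measurable_fun [set: R] (pt ^~ t).
  by apply: continuous_measurable_fun; exact: (slice_cont _ ct).1.
have cpx x : continuous (px x) by exact: (slice_cont _ cx).2.
have zero_side x t : A <= `|x| -> [/\ p x t = 0, px x t = 0 & pt x t = 0].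
  by move=> Ax; apply: zero => -[]; rewrite ltNge Ax.
have zero_end x t : t <= a \/ b <= t -> [/\ p x t = 0, px x t = 0 & pt x t = 0].
  by move=> tab; apply: zero => -[_ /andP[at_ tb]]; case: tab; rewrite leNgt ?at_ ?tb.
have p_side t : p A t = 0 /\ p (- A) t = 0.
  by split; [have [] := zero_side A t|have [] := zero_side (- A) t];
    rewrite ?normrN ?(gtr0_norm A0).
have p_end x : p x a = 0 /\ p x b = 0.
  by split; [have [] := zero_end x a (or_introl (lexx _))|
             have [] := zero_end x b (or_intror (lexx _))].
have mk := weak_density_measurable A0 (ltW ab) L0 B0 M0 fc V_lip hB VR mU Ub Ud
  p_lip p_time_lip p_bound px_bound dx dt mpx mpt cpx p_side.
have ik := weak_density_integral A0 (ltW ab) L0 B0 M0 fc V_lip hB VR mU Ub Ud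
  p_lip p_time_lip p_bound px_bound dx dt mpx mpt cpx p_side p_end.
have k_end t : t <= a \/ b <= t -> k t = 0.
  move=> tab; have -> : k t = \int[leb]_(x in `[- A, A]) 0.
    by apply: eq_Rintegral => x _; have [_ -> ->] := zero_end x t tab; rewrite !mulr0 addr0.
  by rewrite /Rintegral integral0.
have kT : k = k \_ (`[a, b]%classic : set R).
  apply/funext => t; rewrite patchE; case: ifPn => // tab.
  apply: k_end; case: (leP t a) => ta; [by left|right; rewrite leNgt; apply/negP => tb].
  by move: tab; rewrite notin_setE; apply; rewrite /= in_itv/= !ltW.
(* Since [k] vanishes outside []a, b[] and [0 < a], integrals over []0, +oo[] and over [[a, b]]
   agree. *)
have k_patch t : ((EFin \o k) \_ (`]0, +oo[%classic : set R)) t =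
    ((fun t => (k t)%:E) \_ (`[a, b]%classic : set R)) t.
  rewrite !patchE /= !mem_setE !in_itv/= andbT.
  have [t0|t0] := ltP 0 t; have [ta|ta] := leP a t => //=.
  - by have [//|tb] := leP t b; rewrite k_end//; right; exact: ltW.
  - by rewrite k_end//; left; exact: ltW.
  - by have := lt_le_trans a0 ta; rewrite ltNge t0.
have mkT : measurable_fun [set: R] k.
  by rewrite kT; apply/(measurable_restrictT _ (measurable_itv `[a, b])).
(* On almost every slice [v] is the solution, and the support of [phi] cuts the integral down to
   [[- A, A]]. *)
have inner : \forall t \ae leb, 0 < t -> (\int[leb]_x (v (x, t) * partial_t phi (x, t)
    + f (v (x, t)) * partial_x phi (x, t))%:E = (k t)%:E)%E.
  have := slices_ae2 vU; apply: filterS => t vUt t0.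
  have [tab|] := pselect (t <= a \/ b <= t).
    rewrite k_end// integral0_eq// => x _.
    have [_ + +] := zero_end x t tab; rewrite /px /pt => -> ->.
    by rewrite !mulr0 addr0.
  move=> /not_orP[/negP]; rewrite -ltNge => ta _.
  (* The two terms bound [f] on [[- L, L]] from above and from below, both by convexity. *)
  pose Kf := `|Num.max (f L) (f (- L))| + `|f 0 *+ 2 - Num.max (f L) (f (- L))|.
  have Kf0 : 0 <= Kf by exact: addr_ge0.
  have fUb x : `|U x t| <= L -> `|f (U x t)| <= Kf.
    move=> Ux; have := cvx_le_max cf Ux; have := cvx_ge cf Ux; rewrite /Kf.
    move: (Num.max _ _) => N; move: (f 0 *+ 2 - N) => N' h1 h2.
    have := ler_norm N; have := ler_norm (- N'); rewrite normrN => h3 h4.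
    have := normr_ge0 N; have := normr_ge0 N' => h5 h6.
    by rewrite ler_norml; apply/andP; split; lra.
  have mlim : measurable_fun [set: R] (fun x => U x t * pt x t + f (U x t) * px x t).
    apply: measurable_funD; apply: measurable_funM => //; first exact: mU (ltW ta).
    by apply: measurableT_comp; [exact: continuous_measurable_fun|exact: mU (ltW ta)].
  have ilim : leb.-integrable `[- A, A]
      (EFin \o (fun x => U x t * pt x t + f (U x t) * px x t)).
    apply: (@ae_bounded_integrable _ _ (L * M + Kf * M)).
    - exact: measurable_funTS.
    - by rewrite addr_ge0// mulr_ge0.
    - apply: filterS (Ub t (ltW ta)) => x Ux _.
      rewrite (le_trans (ler_normD _ _))// !normrM lerD//; apply: ler_pM => //.
        by have [_ _ pM] := hM1 (x, t); rewrite (le_trans pM)// lerDl.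
      exact: fUb.
  have t1 : 0 < t < t + 1 by rewrite t0 ltrDl ltr01.
  have t10 : 0 < t + 1 by case/andP : t1 => /lt_trans; exact.
  have mv := measurable_strip_slice (lv _ t10) t1.
  have mvlim : measurable_fun [set: R] (fun x => v (x, t) * pt x t + f (v (x, t)) * px x t).
    apply: measurable_funD; apply: measurable_funM => //.
    by apply: measurableT_comp; [exact: continuous_measurable_fun|exact: mv].
  transitivity (\int[leb]_(x in `[(- A)%R, A])
      (v (x, t) * pt x t + f (v (x, t)) * px x t)%:E)%E.
    rewrite [RHS]integral_mkcond; apply: eq_integral => x _; rewrite patchE.
    case: ifPn => // /negP xA; rewrite -/(pt x t) -/(px x t).
    have [|_ -> ->] := zero_side x t; last by rewrite !mulr0 addr0.
    rewrite leNgt; apply/negP; rewrite ltr_norml => /andP[x1 x2]; apply: xA.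
    by rewrite inE/= in_itv/= !ltW.
  rewrite /k /Rintegral fineK; last exact: integrable_fin_num.
  apply: ae_eq_integral => //.
  - by apply/measurable_EFinP; exact: measurable_funTS.
  - by apply/measurable_EFinP; exact: measurable_funTS.
  - by apply: filterS vUt => x vx _; rewrite vx//; exact/halfplaneP.
(* Replacing the inner integral by [k] for almost every [t] requires it to be measurable in [t],
   which joint measurability gives. *)
have mg : measurable_fun halfplane
    (fun z => v z * partial_t phi z + f (v z) * partial_x phi z).
  have mv := measurable_halfplane_strips lv.
  have mtest (g : R * R -> R) : continuous g -> measurable_fun halfplane g.
    by move=> cg'; apply: open_continuous_measurable_fun2; [exact: halfplane_open|move=> z _; exact: cg'].
  apply: measurable_funD; apply: measurable_funM => //.
  - exact: mtest.
  - by apply: measurableT_comp => //; exact: continuous_measurable_fun.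
  - exact: mtest.
rewrite (ae_eq_integral (EFin \o (k : measurableTypeR R -> R)))//.
- rewrite -[RHS]ik [LHS]integral_mkcond [RHS]integral_mkcond; apply: eq_integral => t _.
  exact: k_patch.
- exact: measurable_slice_integral mg.
- by apply/measurable_EFinP; exact: measurable_funTS.
- by apply: filterS inner => t kt /=; rewrite in_itv/= andbT => /kt.
Qed.

End hj_weak.

Theorem theorem2 (R : realType) (f : R -> R)
    (f_convex : convex_function (E := R^o) [set: R^o] f)
    (f_superlinear : superlinear f) :
  [/\ (* 1 *)
      forall u10 u20 : R -> R,
        Loo leb setT u10 -> Loo leb setT u20 ->
        (\forall x \ae leb, u10 x <= u20 x) ->
        \forall z \ae leb2, halfplane z ->
          hj_solution f u10 z <= hj_solution f u20 z,
      (* 2 *)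
      forall (u0 : 'I_2 -> R -> R) (u0n : 'I_2 -> nat -> R -> R),
        (forall i, L1 leb setT (u0 i)) ->
        (forall i n, Loo leb setT (u0n i n) /\ L1 leb setT (u0n i n)) ->
        (forall i, L1cvg leb setT (u0n i) (u0 i)) ->
        [/\ (* a *)
            forall T : R, 0 < T -> forall i,
              L1cauchy leb2 (strip T) (fun n => hj_solution f (u0n i n)),
            (* b *)
            forall T : R, 0 < T -> forall u : 'I_2 -> R * R -> R,
              (forall i, L1cvg leb2 (strip T)
                           (fun n => hj_solution f (u0n i n)) (u i)) ->
              forall tau : R, 0 < tau < T ->
              (\int[leb]_x \int[leb]_(t in `]tau, T[)
                  `|u ord0 (x, t) - u ord_max (x, t)|%:E
               <= (T - tau)%:E *
                  \int[leb]_x `|u0 ord0 x - u0 ord_max x|%:E)%E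
          & (* c *)
            forall (i : 'I_2) (v0n : nat -> R -> R) (ui vi : R * R -> R),
              (forall n, Loo leb setT (v0n n) /\ L1 leb setT (v0n n)) ->
              L1cvg leb setT v0n (u0 i) ->
              (forall T : R, 0 < T ->
                L1cvg leb2 (strip T) (fun n => hj_solution f (u0n i n)) ui) ->
              (forall T : R, 0 < T ->
                L1cvg leb2 (strip T) (fun n => hj_solution f (v0n n)) vi) ->
              \forall z \ae leb2, halfplane z -> ui z = vi z]
    & (* 3 *)
      forall (u0 : R -> R) (u0n : nat -> R -> R) (u : R * R -> R),
        L1 leb setT u0 ->
        (forall n, Loo leb setT (u0n n) /\ L1 leb setT (u0n n)) ->
        L1cvg leb setT u0n u0 ->
        (forall T : R, 0 < T ->
          L1cvg leb2 (strip T) (fun n => hj_solution f (u0n n)) u) ->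
        [/\ (* a *)
            forall K : set (R * R), compact K -> K `<=` halfplane ->
              Loo leb2 K u,
            (* b *)
            forall phi : R * R -> R, test_function halfplane phi ->
              (\int[leb]_(t in `]0%R, +oo[) \int[leb]_x
                 (u (x, t) * partial_t phi (x, t)
                  + f (u (x, t)) * partial_x phi (x, t))%:E = 0)%E
          & (* c *)
            forall a b : R, a <= b ->
              ess_cvg_at_0
                (fun t => \int[leb]_(x in `[a, b]) (u (x, t))%:E)%E
                (\int[leb]_(x in `[a, b]) (u0 x)%:E)%E]].
Proof.
have cf := convex_function_cvx f_convex.
have sf := superlinear_superlin cf f_superlinear.
split.
- by move=> u10 u20 b1 b2; apply: hj_comparison => //; exact: Loo_admissible.
- move=> u0 u0n l0 l0n cvg0.
  have lun i n : L1 leb setT (u0n i n) by have [] := l0n i n.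
  split.
  + move=> T T0 i.
    have lU n : L1 leb2 (strip T) (hj_solution f (u0n i n)) by exact: hj_L1.
    exact: (L1cvg_cauchy (mu := leb2) (strip_measurable T) lU
      (hj_L1cvg sf (l0 i) (lun i) (cvg0 i) T0)).
  + move=> T T0 u cu tau tauT.
    have uE i := hj_limit sf (l0 i) (lun i) (cvg0 i) T0 (cu i).
    exact: (hj_limits_contraction sf (l0 ord0) (l0 ord_max) (cu ord0).1 (cu ord_max).1
      (uE ord0) (uE ord_max) tauT).
  + move=> i v0n ui vi l0v cv0 cui cvi.
    have lvn n : L1 leb setT (v0n n) by have [] := l0v n.
    apply: filterS2 (hj_limit_halfplane sf (l0 i) (lun i) (cvg0 i) cui)
      (hj_limit_halfplane sf (l0 i) lvn cv0 cvi) => z uz vz Hz.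
    by rewrite uz// vz.
- move=> u0 u0n u l0 l0n cvg0 cu.
  have lun n : L1 leb setT (u0n n) by have [] := l0n n.
  have uE := hj_limit_halfplane sf l0 lun cvg0 cu.
  have lu T : 0 < T -> L1 leb2 (strip T) u by move=> /cu[].
  split.
  + move=> K; exact: (hj_limit_Loo sf l0 lu uE).
  + move=> phi; exact: (hj_limit_weak cf sf l0 lu uE).
  + move=> a b; exact: (hj_limit_initial sf l0 lu uE).
Qed.
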